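(* Let $n\ge 1$, let $\mathbf{T}$ be an $n$-string tangle, and fix an ordering $x_1,\dots,x_{2n}$ of the endpoint arcs (i.e. of the $2n$ endpoints of the strings on the boundary sphere). For a diagram of $\mathbf{T}$, let $\mathbf{M_T}$ be a $k\times(k+n)$ integer coloring matrix obtained from that diagram, whose last $2n$ columns correspond to the endpoint arcs in the fixed order, and let $SF(\mathbf{M_T})$ be its standard echelon form. Then the following are invariants of the $n$-string tangle $\mathbf{T}$, i.e. they depend only on the tangle $\mathbf{T}$ and the fixed ordering of the endpoint arcs, not on the choice of diagram or on the labeling of the arcs that are not endpoint arcs: (1) $\mathbf{d_U(T)}$, the absolute value of the determinant of the upper left-hand corner $(k-n)\times(k-n)$ submatrix of $SF(\mathbf{M_T})$; (2) $\mathbf{M_l(T)}$, the $n\times 2n$ lower right-hand corner submatrix of $SF(\mathbf{M_T})$.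
   Context: An $n$-string tangle is a 3-ball with $n$ strings (arcs) properly embedded in it; the boundary of the 3-ball and the $2n$ endpoints of the strings are not allowed to move, so two tangles are the same if they are related by an ambient isotopy of the ball fixing the boundary pointwise. Equivalently, two diagrams (regular projections to a disk with over/under information, the endpoints lying at fixed points of the boundary circle) represent the same tangle if and only if they are related by planar isotopy fixing the boundary and Reidemeister moves I, II, III inside the disk. An arc of a diagram is a maximal connected piece of the diagram running between undercrossings and/or endpoints. An endpoint arc is an arc having an endpoint on the boundary; the other arcs are interior arcs. Coloring matrix: assign a variable to each arc. If a string projects to a single arc (it never passes under), that arc has both endpoints on the boundary; it is then given two variables $x_i,x_j$, one for each of its endpoints, and the equation $x_i-x_j=0$ is added. Thus there are exactly $2n$ distinct variables for the endpoint arcs. Each crossing with overarc $x$ and underarcs $y,z$ gives the equation $y+z-2x=0$ (coefficients are added if some of these arcs coincide). The coefficient matrix over $\mathbb{Z}$ of all these equations has one row per equation and one column per variable, the interior-arc variables coming first (in any order) and the $2n$ endpoint-arc variables last in the fixed order. If $k$ is the number of equations, there are $k+n$ variables, of which $k-n$ are interior. A coloring matrix of $\mathbf{T}$ is such a $k\times(k+n)$ matrix or any matrix obtained from it by the allowed row operations: exchanging two rows, adding an integer multiple of one row to a different row, multiplying a row by $-1$ (no other scaling). Standard echelon form: using the allowed row operations any integer matrix can be put in standard echelon form, meaning: (i) it is in (row) echelon form; (ii) its leading entries (first nonzero entries of rows) are positive; (iii) if $a_{ij}$ is the leading entry of row $i$, then $0\le a_{\lambda j}\le a_{ij}-1$ for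 all $1\le\lambda<i$. This form is unique, and $SF(\mathbf{M})$ denotes the standard echelon form of $\mathbf{M}$. The determinant of a $0\times 0$ matrix is $1$. *)

(* Defs.v *)
From HB Require Import structures.
From mathcomp Require Import all_boot all_order all_fingroup all_algebra.
From Stdlib Require Import ClassicalEpsilon.

Set Implicit Arguments.
Unset Strict Implicit.
Unset Printing Implicit Defensive.

Import Order.TTheory GRing.Theory Num.Theory.
Local Open Scope ring_scope.

(** * Tangle diagrams

    A diagram in the disk is encoded as a combinatorial map.  A dart is a germ
    of edge, either at a crossing or at an endpoint on the boundary circle.
    - [inl (v, i)] is the [i]-th dart at the crossing [v]; the four darts of a
      crossing are numbered counterclockwise modulo 4, the understrand being
      [0, 2] and the overstrand [1, 3].
    - [inr j] is the dart at the [j]-th endpoint; the [2n] endpoints are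
      numbered counterclockwise along the boundary circle. *)

Definition dart (n : nat) (X : finType) : finType :=
  ((X * 'Z_4) + 'I_(n + n))%type.

Definition over (i : 'Z_4) : bool := odd i.

Section Darts.
Variables (n : nat) (X : finType).
Implicit Types (d : dart n X) (g : dart n X -> dart n X).

(** Counterclockwise rotation of the darts about their vertex.  The complement
    of the disk in the sphere is collapsed to one more vertex, around which the
    endpoints are met in the order opposite to that of the boundary circle. *)
Definition turn d : dart n X :=
  match d with
  | inl (v, i) => inl (v, i + 1)
  | inr j => inr (ord_pred j)
  end.

Definition through d : dart n X :=
  match d with
  | inl (v, i) => inl (v, i + 2)
  | inr j => inr j
  end.

Definition strand_rel g : rel (dart n X) :=
  [rel d d' | (d' == g d) || (d' == through d)].

Definition is_over d : bool := if d is inl (_, i) then over i else false.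

(** Steps along a string that do not go through an undercrossing. *)
Definition arc_rel g : rel (dart n X) :=
  [rel d d' | (d' == g d) || is_over d && (d' == through d)].

(** The faces of the map are the orbits of [turn \o g]. *)
Definition nfaces g : nat := fcard (fun d => turn (g d)) predT.

End Darts.

(** [glue] matches the two darts of each edge.  [no_loop] says that there is no
    closed component; then the graph is connected (through the outer vertex),
    and [planar] is Euler's formula for [#|crossing| + 1] vertices and
    [2 #|crossing| + n] edges, so that [glue] determines a diagram in the disk
    up to isotopy fixing the boundary circle, and conversely. *)
Record diagram (n : nat) := Diagram {
  crossing : finType;
  glue : dart n crossing -> dart n crossing;
  glueK : involutive glue;
  glue_neq : forall d, glue d != d;
  no_loop : forall d, exists j : 'I_(n + n), connect (strand_rel glue) d (inr j);
  planar : (#|crossing|.+1 + nfaces glue = (#|crossing|.*2 + n) + 2)%N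
}.

Arguments glue {n} _ _.

(** * Planar isotopy and Reidemeister moves *)

(** Renaming of the crossings.  The numbering of the darts of a crossing is only
    determined up to a half turn, whence [r]. *)
Definition embed (n : nat) (X Y : finType) (f : X -> Y) (r : X -> bool)
    (d : dart n X) : dart n Y :=
  match d with
  | inl (v, i) => inl (f v, if r v then i + 2 else i)
  | inr j => inr j
  end.

Definition iso_glue (n : nat) (X Y : finType)
    (g : dart n X -> dart n X) (h : dart n Y -> dart n Y) : Prop :=
  exists (f : X -> Y) (r : X -> bool),
    bijective f /\ forall d, h (embed f r d) = embed f r (g d).

Definition isotopic (n : nat) (D E : diagram n) : Prop :=
  iso_glue (glue D) (glue E).

(** [runs D S d d']: the piece of string that leaves along [d] and goes straight
    through some crossings of [S] arrives at [d']. *)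
Inductive runs (n : nat) (D : diagram n) (S : {set crossing D})
    (d : dart n (crossing D)) : dart n (crossing D) -> Prop :=
| runs_edge : runs S d (glue D d)
| runs_through v i : v \in S -> runs S d (inl (v, i)) ->
    runs S d (glue D (inl (v, i + 2))).

(** [E] is obtained from [D] by deleting the crossings in [S], each of the
    two strands at a deleted crossing being continued straight on. *)
Definition erases (n : nat) (D : diagram n) (S : {set crossing D})
    (E : diagram n) : Prop :=
  exists (f : crossing E -> crossing D) (r : crossing E -> bool),
    [/\ injective f, (forall v, (v \in S) = (v \notin codom f)) &
        forall d, runs S (embed f r d) (embed f r (glue E d))].

(** Removal of a kink: the crossing [v] bounds a monogon. *)
Definition reidemeister1 (n : nat) (D E : diagram n) : Prop :=
  exists (v : crossing D) (i : 'Z_4),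
    glue D (inl (v, i)) = inl (v, i + 1) /\ erases [set v] E.

(** Removal of a bigon with corners [v], [w]: one of its sides runs from dart
    [i + 1] of [v] to dart [j] of [w], the other one from dart [i] of [v] to
    dart [j + 1] of [w].  A side is over at both ends or under at both ends. *)
Definition reidemeister2 (n : nat) (D E : diagram n) : Prop :=
  exists (v w : crossing D) (i j : 'Z_4),
    [/\ v != w, glue D (inl (v, i + 1)) = inl (w, j),
        glue D (inl (v, i)) = inl (w, j + 1), over (i + 1) = over j &
        erases [set v; w] E].

(** Let [x 0, x 1, x 2] be the corners, in counterclockwise order, of a
    triangle, whose sides at [x t] are the darts [a t] (towards [x (t + 1)]) and
    [a t + 1] (towards [x (t - 1)]).  Moving each string across the crossing of
    the other two reverses the order of the two crossings on each of the three
    strings, while the crossings are merely translated.  So the string through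
    [x t] and [x (t + 1)] exchanges the roles of its darts at these crossings:
    [a t] at [x t] with [a (t + 1) + 3] at [x (t + 1)], and
    [a t + 2] at [x t] with [a (t + 1) + 1] at [x (t + 1)]. *)
Definition slide (n : nat) (X : finType) (x : 'Z_3 -> X) (a : 'Z_3 -> 'Z_4)
    (d : dart n X) : dart n X :=
  match d with
  | inl (v, i) =>
      match [pick t | x t == v] with
      | Some t =>
          if i == a t then inl (x (t + 1), a (t + 1) + 3)
          else if i == a t + 1 then inl (x (t - 1), a (t - 1) + 2)
          else if i == a t + 2 then inl (x (t + 1), a (t + 1) + 1)
          else inl (x (t - 1), a (t - 1))
      | None => d
      end
  | inr j => d
  end.

(** At [x t] the string through [x t] and [x (t + 1)] lies over the other one if
    and only if [a t] is odd.  Hence the three strings are vertically ordered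
    (top, middle, bottom) exactly when the [a t] do not all have the same
    parity. *)
Definition reidemeister3 (n : nat) (D E : diagram n) : Prop :=
  exists (x : 'Z_3 -> crossing D) (a : 'Z_3 -> 'Z_4),
    [/\ injective x,
        forall t, glue D (inl (x t, a t)) = inl (x (t + 1), a (t + 1) + 1),
        exists s t, over (a s) != over (a t) &
        iso_glue (fun d => slide x a (glue D (slide x a d))) (glue E)].

(** Two diagrams represent the same tangle. *)
Inductive same_tangle (n : nat) : diagram n -> diagram n -> Prop :=
| same_isotopic D E : isotopic D E -> same_tangle D E
| same_R1 D E : reidemeister1 D E -> same_tangle D E
| same_R2 D E : reidemeister2 D E -> same_tangle D E
| same_R3 D E : reidemeister3 D E -> same_tangle D E
| same_sym D E : same_tangle D E -> same_tangle E D
| same_trans D E F : same_tangle D E -> same_tangle E F -> same_tangle D F.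

(** * Row operations and the standard echelon form *)

Inductive row_equiv (p q : nat) (A : 'M[int]_(p, q)) : 'M[int]_(p, q) -> Prop :=
| row_equiv_refl : row_equiv A A
| row_equiv_swap B i1 i2 : row_equiv A B -> row_equiv A (xrow i1 i2 B)
| row_equiv_add B i1 i2 (c : int) : i1 != i2 -> row_equiv A B ->
    row_equiv A (\matrix_(i, j) (if i == i1 then B i j + c * B i2 j else B i j))
| row_equiv_opp B i1 : row_equiv A B ->
    row_equiv A (\matrix_(i, j) (if i == i1 then - B i j else B i j)).

Definition leading (p q : nat) (A : 'M[int]_(p, q)) (i : 'I_p) (j : 'I_q) : Prop :=
  A i j != 0 /\ forall l : 'I_q, (l < j)%N -> A i l = 0.

(** The rows above a nonzero row are nonzero, with leading entries further to
    the left. *)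
Definition echelon (p q : nat) (A : 'M[int]_(p, q)) : Prop :=
  forall (h i : 'I_p) (j : 'I_q), (h < i)%N -> leading A i j ->
    exists2 l : 'I_q, (l < j)%N & leading A h l.

Definition standard_echelon (p q : nat) (A : 'M[int]_(p, q)) : Prop :=
  [/\ echelon A,
      forall i j, leading A i j -> 0 < A i j &
      forall i j, leading A i j ->
        forall h : 'I_p, (h < i)%N -> 0 <= A h j <= A i j - 1].

(** The matrix in standard echelon form that is row equivalent to [A]; it exists
    and is unique (Hermite normal form). *)
Definition SF (p q : nat) (A : 'M[int]_(p, q)) : 'M[int]_(p, q) :=
  epsilon (inhabits A) (fun S => row_equiv A S /\ standard_echelon S).

(** * Coloring matrices *)

Section Coloring.
Variables (n : nat) (D : diagram n).

Definition arcs : {set {set dart n (crossing D)}} :=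
  equivalence_partition (connect (arc_rel (glue D))) [set: dart n (crossing D)].

Definition interior_arc : finType :=
  {A : {set dart n (crossing D)} |
     (A \in arcs) && [forall j : 'I_(n + n), inr j \notin A]}.

(** There is one variable per interior arc and one per endpoint, so that an arc
    with two endpoints has two variables. *)
Definition variable : finType := (interior_arc + 'I_(n + n))%type.

(** [x] is a variable of the arc that contains [d]. *)
Definition variable_at (d : dart n (crossing D)) (x : variable) : Prop :=
  match x with
  | inl A => d \in val A
  | inr j => connect (arc_rel (glue D)) (inr j) d
  end.

(** The strings that never pass under, given by their endpoints. *)
Definition uncut_string : finType :=
  {p : 'I_(n + n) * 'I_(n + n) |
     (p.1 < p.2)%N && connect (arc_rel (glue D)) (inr p.1) (inr p.2)}.

Definition equation : finType := (crossing D + uncut_string)%type.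

(** [c] is the vector of coefficients of the equation [e].  When the overarc of
    a crossing has two endpoints, any of its two variables may be used. *)
Definition coefficients (e : equation) (c : variable -> int) : Prop :=
  match e with
  | inl v => exists x y z : variable,
      [/\ variable_at (inl (v, 1)) x, variable_at (inl (v, 0)) y,
          variable_at (inl (v, 2)) z &
          forall u, c u = (u == y)%:R + (u == z)%:R - 2 * (u == x)%:R]
  | inr p => forall u, c u = (u == inr (val p).1)%:R - (u == inr (val p).2)%:R
  end.

(** The interior arcs come first, in the order [iota], then the endpoints, in
    the order [sigma]. *)
Definition column_variable (sigma : {perm 'I_(n + n)}) (m : nat)
    (iota : 'I_m -> interior_arc) (j : 'I_(m + (n + n))) : variable :=
  match split j with
  | inl a => inl (iota a)
  | inr b => inr (sigma b)
  end.

(** With [m] interior arcs and [k = m + n] equations, the format [k] by [k + n]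
    is written [m + n] by [m + (n + n)], which is also the block decomposition
    that is used below. *)
Definition coloring_matrix (sigma : {perm 'I_(n + n)}) (m : nat)
    (M : 'M[int]_(m + n, m + (n + n))) : Prop :=
  exists (iota : 'I_m -> interior_arc) (rho : 'I_(m + n) -> equation)
         (M0 : 'M[int]_(m + n, m + (n + n))),
    [/\ bijective iota, bijective rho,
        forall i, exists2 c, coefficients (rho i) c &
          forall j, M0 i j = c (column_variable sigma iota j) &
        row_equiv M0 M].

End Coloring.

Definition dU (m n : nat) (M : 'M[int]_(m + n, m + (n + n))) : int :=
  `|\det (ulsubmx (SF M))|.

Definition Ml (m n : nat) (M : 'M[int]_(m + n, m + (n + n))) : 'M[int]_(n, n + n) :=
  drsubmx (SF M).

(* Main.v *)
Require Import Defs.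
From HB Require Import structures.
From mathcomp Require Import all_boot all_order all_fingroup all_algebra.
From mathcomp Require Import zify.
From Stdlib Require Import ClassicalEpsilon FunctionalExtensionality.

Set Implicit Arguments.
Unset Strict Implicit.
Unset Printing Implicit Defensive.

Import Order.TTheory GRing.Theory Num.Theory.
(* [over] is to be the predicate on darts, not the ssreflect constant. *)
Import Defs.
Local Open Scope ring_scope.

(** The relations of the coloring matrix present an abelian group, generated by
    the colors of the arcs, with a distinguished family of [2n] elements, the
    colors of the endpoints.  It is the universal group in which the diagram
    can be colored: for every abelian group [H] the colorings in [H] are given
    by the homomorphisms to [H].  Therefore it is determined, up to an
    isomorphism that respects the distinguished family, by the colorings alone
    ([universal_iso]).

    Colorings are handled as functions on the darts, rather than on the arcs.
    A Reidemeister move gives a bijection between the colorings of the two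
    diagrams, with the same colors at the endpoints and compatible with
    homomorphisms ([interchangeable]), so that both diagrams have the same
    universal group ([same_tangle_universal]).
    - Moves I and II erase crossings.  The colorings of the small diagram are
      the colorings of the large one for which the erased crossings have no
      effect ([interchangeable_erasure]).  These correspond to the true
      colorings: at a kink all four colors agree ([interchangeable_kink]), at a
      bigon the string below is reflected twice in the same color
      ([interchangeable_bigon]).
    - Move III keeps the colors outside of the triangle.  The three sides get
      new colors, and the rules at the three corners are consistent because
      reflections are distributive over each other ([interchangeable_triangle]).

    It remains to read off both invariants from the cokernel of the matrix,
    that is, from its row lattice.  The standard echelon form [S] exists
    ([SF_spec]) and is determined by the row lattice
    ([standard_echelon_unique]).  Its lower left corner is zero and its upper
    left corner [U] presents the quotient of the group by the colors of the
    endpoints.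
    - For presentations [U] and [U'] of one group, the relations in the
      generators of both are generated by [U] and the expressions of the new
      generators by the old ones, or the other way round
      ([joint_relations]).  So the two block matrices divide each other, whence
      the equality of the determinants and that of the nullities of [U], [U'].
    - The relations between the colors of the endpoints form a lattice that
      depends only on the group.  The rows of [S] that vanish in the first
      columns give a matrix in standard echelon form for this lattice.  Their
      number is [n] plus the nullity of [U], and the lower right corner of [S]
      consists of the last [n] of them ([corner_tail]).  So a singular [U] does
      no harm: it has the same nullity for all diagrams. *)

(** * Universal colorings *)

Section Universal.
Variable N : nat.

(** A kind of coloring of [Y] is a family of predicates [P G] on the functions
    from [Y] to an abelian group [G].  The group [G] with the family [b] is
    [universal] if [b] is the boundary of a coloring in [G] from which every
    coloring in every group is obtained by a unique homomorphism. *)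
Definition universal (Y : Type) (bd : 'I_N -> Y)
    (P : forall G : zmodType, (Y -> G) -> Prop) (G : zmodType) (b : 'I_N -> G) :=
  exists c : Y -> G, [/\ P G c, forall j, c (bd j) = b j &
    forall (H : zmodType) (c' : Y -> H), P H c' ->
      exists h : {additive G -> H}, (forall y, h (c y) = c' y) /\
        forall h' : {additive G -> H}, (forall y, h' (c y) = c' y) -> h' =1 h].

(** Compatibility of an operation on functions with homomorphisms of the
    groups of colors. *)
Definition natural (Y Z : Type)
    (Phi : forall G : zmodType, (Y -> G) -> Z -> G) :=
  forall (G H : zmodType) (h : {additive G -> H}) (c : Y -> G),
    Phi H (h \o c) =1 h \o Phi G c.

(** Colorings of two kinds are interchangeable if they correspond bijectively
    and naturally in the group, with the same boundary. *)
Definition interchangeable (Y Z : Type) (bY : 'I_N -> Y) (bZ : 'I_N -> Z)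
    (P : forall G : zmodType, (Y -> G) -> Prop)
    (Q : forall G : zmodType, (Z -> G) -> Prop) :=
  exists (Phi : forall G : zmodType, (Y -> G) -> Z -> G)
         (Psi : forall G : zmodType, (Z -> G) -> Y -> G),
    [/\ natural Phi /\ natural Psi,
        forall (G : zmodType) (c : Y -> G), P G c ->
          [/\ Q G (Phi G c), Psi G (Phi G c) =1 c & Phi G c \o bZ =1 c \o bY] &
        forall (G : zmodType) (e : Z -> G), Q G e ->
          [/\ P G (Psi G e), Phi G (Psi G e) =1 e & Psi G e \o bY =1 e \o bZ]].

Lemma interchangeable_sym (Y Z : Type) (bY : 'I_N -> Y) (bZ : 'I_N -> Z) P Q :
  interchangeable bY bZ P Q -> interchangeable bZ bY Q P.
Proof. by case=> Phi [Psi [[nPhi nPsi] PQ QP]]; exists Psi, Phi. Qed.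

Lemma universal_transfer (Y Z : Type) (bY : 'I_N -> Y) (bZ : 'I_N -> Z) P Q
    (G : zmodType) (b : 'I_N -> G) :
  interchangeable bY bZ P Q -> universal bY P b -> universal bZ Q b.
Proof.
case=> Phi [Psi [[nPhi nPsi] PQ QP]] [c [Pc cb cU]].
have [Qc cK bdc] := PQ _ _ Pc.
exists (Phi G c); split=> [//|j|H e Qe].
  by rewrite -cb; apply: bdc.
have [Pe eK _] := QP _ _ Qe.
have [h [hc hU]] := cU _ _ Pe.
exists h; split=> [z|h' h'e].
  rewrite -[LHS]/((h \o Phi G c) z) -nPhi -[RHS]eK.
  by congr (Phi H _ z); apply: functional_extensionality => y; apply: hc.
apply: hU => y; rewrite -cK -[LHS]/((h' \o Psi G (Phi G c)) y) -nPsi.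
by congr (Psi H _ y); apply: functional_extensionality => z; apply: h'e.
Qed.

Lemma universal_iso (Y : Type) (bd : 'I_N -> Y) P (G G' : zmodType)
    (b : 'I_N -> G) (b' : 'I_N -> G') :
  universal bd P b -> universal bd P b' ->
  exists (h : {additive G -> G'}) (h' : {additive G' -> G}),
    [/\ cancel h h', cancel h' h, forall j, h (b j) = b' j &
        forall j, h' (b' j) = b j].
Proof.
case=> c [Pc cb cU] [c' [Pc' cb' cU']].
have [h [hc _]] := cU _ _ Pc'; have [h' [hc' _]] := cU' _ _ Pc.
have [k [kc kU]] := cU _ _ Pc; have [k' [kc' kU']] := cU' _ _ Pc'.
exists h, h'; split=> [x|x|j|j].
- transitivity (k x).
    by apply: (kU (h' \o h : {additive G -> G})) => y /=; rewrite hc hc'.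
  by symmetry; apply: (kU idfun).
- transitivity (k' x).
    by apply: (kU' (h \o h' : {additive G' -> G'})) => y /=; rewrite hc' hc.
  by symmetry; apply: (kU' idfun).
- by rewrite -cb -cb' hc.
- by rewrite -cb -cb' hc'.
Qed.

End Universal.

(** * Colorings of the darts of a diagram *)

(** The arithmetic of the four darts of a crossing. *)
Lemma Z4_cases (a i : 'Z_4) : [\/ i = a, i = a + 1, i = a + 2 | i = a + 3].
Proof.
have: [|| i == a, i == a + 1, i == a + 2 | i == a + 3].
  by move: a i; do 2!case=> [[|[|[|[|//]]]] ?].
by case/or4P => /eqP ->; [exact: Or41 | exact: Or42 | exact: Or43 | exact: Or44].
Qed.

Lemma Z4_neq (a : 'Z_4) :
  ((a + 1 == a) = false) * ((a + 2 == a) = false) * ((a + 3 == a) = false) *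
  ((a + 2 == a + 1) = false) * ((a + 3 == a + 1) = false) *
  ((a + 3 == a + 2) = false) * ((a == a + 1) = false) *
  ((a == a + 2) = false) * ((a == a + 3) = false) *
  ((a + 1 == a + 2) = false) * ((a + 1 == a + 3) = false) *
  ((a + 2 == a + 3) = false).
Proof. by move: a; case=> [[|[|[|[|//]]]] ?]. Qed.

Lemma Z4_add (a : 'Z_4) :
  (a + 1 + 1 = a + 2) * (a + 1 + 2 = a + 3) * (a + 1 + 3 = a) *
  (a + 2 + 1 = a + 3) * (a + 2 + 2 = a) * (a + 2 + 3 = a + 1) *
  (a + 3 + 1 = a) * (a + 3 + 2 = a + 1) * (a + 3 + 3 = a + 2).
Proof. by do !split; apply/eqP; move: a; case=> [[|[|[|[|//]]]] ?]. Qed.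

Lemma overD (a : 'Z_4) :
  (over (a + 1) = ~~ over a) * (over (a + 2) = over a) * (over (a + 3) = ~~ over a).
Proof. by move: a; case=> [[|[|[|[|//]]]] ?]. Qed.

(** The reflection of [y] in [x], that is, the operation of the core quandle of
    an abelian group. *)
Definition mirror (G : zmodType) (x y : G) : G := x *+ 2 - y.

Lemma mirrorK (G : zmodType) (x : G) : involutive (mirror x).
Proof. by move=> y; rewrite /mirror opprB addrC subrK. Qed.

Lemma mirrorxx (G : zmodType) (x : G) : mirror x x = x.
Proof. by rewrite /mirror mulr2n addrK. Qed.

Lemma mirrorD (G : zmodType) (x y z : G) :
  mirror x (mirror y z) = mirror (mirror x y) (mirror x z).
Proof.
rewrite /mirror mulrnBl !opprB [z - x *+ 2]addrC [RHS]addrACA.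
by rewrite [x *+ 2 *+ 2]mulr2n addrK [z - _]addrC.
Qed.

Lemma mirror_additive (G H : zmodType) (h : {additive G -> H}) (x y : G) :
  h (mirror x y) = mirror (h x) (h y).
Proof. by rewrite /mirror raddfB raddfMn. Qed.

Section DartColoring.
Variables (n : nat) (X : finType).
Implicit Types (v : X).

(** The coloring rules at a crossing, for a coloring of the darts: the
    overstrand keeps its color and the colors of the two underarcs are
    exchanged by the reflection in that of the overstrand. *)
Definition fox (G : zmodType) (c : dart n X -> G) v : Prop :=
  forall i : 'Z_4, over i ->
    c (inl (v, i + 2)) = c (inl (v, i)) /\
    c (inl (v, i + 3)) = mirror (c (inl (v, i))) (c (inl (v, i + 1))).

(** Both strands keep their colors. *)
Definition straight (G : zmodType) (c : dart n X -> G) v : Prop :=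
  forall i : 'Z_4, c (inl (v, i + 2)) = c (inl (v, i)).

(** Colorings of the darts, where the two strands at a crossing of [S] ignore
    each other. *)
Definition coloring (g : dart n X -> dart n X) (S : {set X}) (G : zmodType)
    (c : dart n X -> G) : Prop :=
  (forall d, c (g d) = c d) /\
  forall v, if v \in S then straight c v else fox c v.

(** It is enough to check the rules at one of the two over darts. *)
Lemma foxI (G : zmodType) (c : dart n X -> G) v (i : 'Z_4) : over i ->
  c (inl (v, i + 2)) = c (inl (v, i)) ->
  c (inl (v, i + 3)) = mirror (c (inl (v, i))) (c (inl (v, i + 1))) ->
  fox c v.
Proof.
move=> oi ci2 ci3 k; case: (Z4_cases i k) => ->; rewrite ?overD ?oi // => _.
by rewrite !Z4_add ci2 ci3 mirrorK.
Qed.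

(** The rules at a crossing in terms of any over dart [o] and any under dart
    [u], whatever the orientation. *)
Lemma fox_mirror (G : zmodType) (c : dart n X -> G) v (o u : 'Z_4) :
  over o -> ~~ over u -> fox c v ->
  c (inl (v, u + 2)) = mirror (c (inl (v, o))) (c (inl (v, u))).
Proof.
move=> oo; case: (Z4_cases o u) => ->; rewrite ?overD ?oo // => _ /(_ o oo)[_ c3].
  by rewrite Z4_add.
by rewrite Z4_add c3 mirrorK.
Qed.

Lemma fox_mirrorI (G : zmodType) (c : dart n X -> G) v (o u : 'Z_4) :
  over o -> ~~ over u -> c (inl (v, o + 2)) = c (inl (v, o)) ->
  c (inl (v, u + 2)) = mirror (c (inl (v, o))) (c (inl (v, u))) -> fox c v.
Proof.
move=> oo; case: (Z4_cases o u) => ->; rewrite ?overD ?oo // => _ c2 cu.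
  by apply: foxI oo c2 _; rewrite -cu Z4_add.
by apply: foxI oo c2 _; move: cu; rewrite Z4_add => ->; rewrite mirrorK.
Qed.

End DartColoring.

(** The dart at an endpoint. *)
Definition bd (n : nat) (X : finType) (j : 'I_(n + n)) : dart n X := inr j.
Arguments bd {n} X j.

(** * Planar isotopy *)

Section Embed.
Variables (n : nat) (X Y : finType) (f : X -> Y) (r : X -> bool).

Lemma embed_inj : injective f -> injective (embed (n := n) f r).
Proof.
move=> fI [[v i]|j] [[w k]|l] //= [] => [/fI -> | -> //].
by case: (r w) => [/(@addIr _ 2) -> | ->].
Qed.

Lemma fox_embed (G : zmodType) (c : dart n Y -> G) v :
  fox c (f v) <-> fox (c \o embed f r) v.
Proof.
rewrite /fox /=; split=> cv i oi; last first.
  move: (cv i oi) (cv (i + 2)); rewrite overD => C1 /(_ oi).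
  by move: C1; case: (r v); rewrite !Z4_add // => -[-> ->] [].
case: (r v); last exact: cv.
by have:= cv (i + 2); rewrite overD !Z4_add => /(_ oi).
Qed.

End Embed.

Lemma interchangeable_iso (n : nat) (X Y : finType)
    (g : dart n X -> dart n X) (h : dart n Y -> dart n Y) :
  iso_glue g h ->
  interchangeable (bd X) (bd Y) (coloring g set0) (coloring h set0).
Proof.
case=> f [r [[f' fK f'K] hg]].
pose em : dart n X -> dart n Y := embed f r.
pose em' : dart n Y -> dart n X := embed f' (r \o f').
have emK : cancel em em'.
  case=> [[v i]|j] //=; rewrite fK.
  by case: (r v); rewrite ?Z4_add.
have em'K : cancel em' em.
  case=> [[v i]|j] //=; rewrite f'K.
  by case: (r (f' v)); rewrite ?Z4_add.
exists (fun G c => c \o em'), (fun G e => e \o em); split=> //.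
- move=> G c [cg cX]; split=> [|x|//]; last by rewrite /= emK.
  split=> [d|v]; first by rewrite /= -{1}[d]em'K hg -/em emK.
  rewrite inE -[v]f'K; apply/(fox_embed f r).
  have -> : (c \o em') \o embed f r = c.
    by apply: functional_extensionality => d /=; rewrite emK.
  by have:= cX (f' v); rewrite inE.
- move=> G e [eh eY]; split=> [|x|//]; last by rewrite /= em'K.
  split=> [d|v]; first by have := eh (em d); rewrite hg.
  by rewrite inE; apply/(fox_embed f r e v); have:= eY (f v); rewrite inE.
Qed.

(** * Erasing crossings *)

Lemma throughK (n : nat) (X : finType) : involutive (@through n X).
Proof. by case=> [[v i]|j] //=; rewrite Z4_add. Qed.

Section Erasure.
Variables (n : nat) (D E : diagram n) (S : {set crossing D}).
Implicit Types (d : dart n (crossing D)) (x y : dart n (crossing E)).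

(** The darts at the crossings of [S]. *)
Definition erased d : bool := if d is inl (v, _) then v \in S else false.

Lemma erased_through d : erased (through d) = erased d.
Proof. by case: d => [[v i]|j]. Qed.

Lemma runs_next d d' :
  erased d' -> runs S d d' -> runs S d (glue D (through d')).
Proof. by case: d' => [[v i]|j] //= vS; apply: runs_through. Qed.

Lemma runs_inv d d' : runs S d d' ->
  d' = glue D d \/
  exists e, [/\ erased e, runs S d e & d' = glue D (through e)].
Proof.
case=> [|v i vS dd']; first by left.
by right; exists (inl (v, i)).
Qed.

(** A run can only stop outside of [S] at one dart. *)
Lemma runs_unique d a b :
  runs S d a -> runs S d b -> ~~ erased a -> ~~ erased b -> a = b.
Proof.
pose next e := glue D (through e).
have runsP e : runs S d e -> exists k, e = iter k next (glue D d) /\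
    forall l, (l < k)%N -> erased (iter l next (glue D d)).
  elim=> [|v i vS _ [k [ek kS]]]; first by exists 0%N.
  exists k.+1; split; first by rewrite iterS -ek.
  by move=> l; rewrite ltnS leq_eqVlt => /orP[/eqP -> | /kS //]; rewrite -ek.
move=> /runsP[k [-> kS]] /runsP[l [-> lS]] aS bS.
case: (ltngtP k l) => [kl|lk|-> //]; first by rewrite lS in aS.
by rewrite kS in bS.
Qed.

(** Steps along a string inside the erased part. *)
Definition string_rel : rel (dart n (crossing D)) :=
  [rel d d' | (d' == glue D d) || erased d && (d' == through d)].

Lemma string_rel_sym : symmetric string_rel.
Proof.
suff sub d d' : string_rel d d' -> string_rel d' d.
  by move=> d d'; apply/idP/idP; apply: sub.
case/orP=> [/eqP ->|/andP[dS /eqP ->]]; rewrite /string_rel /=; first by rewrite glueK eqxx.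
by rewrite erased_through dS throughK eqxx orbT.
Qed.

Lemma string_connect_sym : connect_sym string_rel.
Proof. exact/sym_connect_sym/string_rel_sym. Qed.

Lemma coloring_string (G : zmodType) (c : dart n (crossing D) -> G) d d' :
  coloring (glue D) S c -> connect string_rel d d' -> c d' = c d.
Proof.
case=> cg cS /connectP[p dp ->] {d'}.
elim: p d dp => //= e p IHp d /andP[de /IHp ->].
case/orP: de => [/eqP -> //|/andP[+ /eqP ->]].
by case: d => [[v i]|j] //= vS; have := cS v; rewrite vS; apply.
Qed.

Lemma connect_runs d d' : runs S d d' -> connect string_rel d d'.
Proof.
elim=> [|v i vS _ dv]; first by apply: connect1; rewrite /string_rel /= eqxx.
apply: connect_trans dv (@connect_trans _ _ (inl (v, i + 2)) _ _ _ _).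
  by apply: connect1; rewrite /string_rel /= vS eqxx orbT.
by apply: connect1; rewrite /string_rel /= eqxx.
Qed.

Variables (f : crossing E -> crossing D) (r : crossing E -> bool).
Hypotheses (f_inj : injective f) (S_codom : forall v, (v \in S) = (v \notin codom f)).
Hypothesis (runsE : forall x, runs S (embed f r x) (embed f r (glue E x))).
Local Notation em := (embed f r).

Lemma erased_em x : erased (em x) = false.
Proof. by case: x => [[v i]|j] //=; rewrite S_codom codom_f. Qed.

Lemma em_or_erased d : ~~ erased d -> exists x, d = em x.
Proof.
case: d => [[v i]|j] /=; last by exists (inr j).
rewrite S_codom negbK => /codomP[w ->].
by exists (inl (w, if r w then i + 2 else i)); rewrite /=; case: (r w); rewrite ?Z4_add.
Qed.

Lemma runs_em x y : runs S (em x) (em y) -> y = glue E x.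
Proof.
move=> xy; apply: (embed_inj (f := f) (r := r) f_inj).
by apply: runs_unique xy (runsE x) _ _; rewrite erased_em.
Qed.

(** A string in the erased part has only its two ends outside of it. *)
Lemma connect_em x y : connect string_rel (em x) (em y) -> y = x \/ y = glue E x.
Proof.
(* The darts met by the string between the two ends [x] and [glue E x]; a dart
   at an erased crossing is met either by a run from [x] that arrives there, or
   where such a run goes on. *)
pose C d := [\/ d = em x, d = em (glue E x) |
  erased d /\ (runs S (em x) d \/ runs S (em x) (through d))].
suff: forall d d', connect string_rel d d' -> C d -> C d'.
  move=> CC xy; have: C (em y) by apply: CC xy _; exact: Or31.
  case=> [/(embed_inj f_inj)|/(embed_inj f_inj)|[]]; [by left|by right|].
  by rewrite erased_em.
have arrive d : runs S (em x) d -> C d.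
  move=> xd; case: (boolP (erased d)) => [dS|]; first by apply: Or33; split=> //; left.
  by case/em_or_erased=> z dz; apply: Or32; rewrite dz in xd *; rewrite (runs_em xd).
have depart d : runs S (em x) d -> C (glue D d).
  case/runs_inv=> [->|[e [eS xe ->]]]; rewrite glueK; first exact: Or31.
  by apply: Or33; rewrite erased_through throughK; split=> //; right.
move=> d d' /connectP[p dp ->] {d'}; elim: p d dp => //= e p IHp d /andP[de /IHp CC] Cd.
apply: CC; case/orP: de => [/eqP ->|/andP[dS /eqP ->]].
- case: Cd => [->|->|[dS [xd|xd]]].
  + exact/arrive/runs_edge.
  + exact/depart/runsE.
  + exact: depart.
  + by apply: arrive; rewrite -[d]throughK; apply: runs_next; rewrite ?erased_through.
case: Cd dS => [->|->|[dS xd] _]; rewrite ?erased_em //.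
apply: Or33; rewrite erased_through throughK; split=> //.
by case: xd; [right|left].
Qed.

(** As there are no closed components, every string ends outside of [S]. *)
Lemma string_end d : exists x, connect string_rel (em x) d.
Proof.
have [j] := no_loop d.
case/connectP=> p; elim: p d => [|d' p IHp] d /=.
  by move=> _ <-; exists (inr j); apply: connect0.
case/andP=> dd' /IHp{IHp} IHp /IHp[x xd'].
case: (boolP (erased d)) => [dS|/em_or_erased[y ->]]; last by exists y.
exists x; apply: connect_trans xd' _; rewrite string_connect_sym.
by apply: connect1; move: dd'; rewrite /strand_rel /string_rel /= dS.
Qed.

(** The colorings of [E] are those of [D] in which the crossings of [S] have no
    effect: each dart of [D] gets the color of the end of its string. *)
Lemma interchangeable_erasure :
  interchangeable (bd (crossing D)) (bd (crossing E))
    (coloring (glue D) S) (coloring (glue E) set0).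
Proof.
have /fin_all_exists[rho rhoP] := string_end.
have rhoE (G : zmodType) (e : dart n (crossing E) -> G) d y :
    coloring (glue E) set0 e -> connect string_rel (em y) d -> e (rho d) = e y.
  move=> [eg _] yd; have: connect string_rel (em (rho d)) (em y).
    by apply: connect_trans (rhoP d) _; rewrite string_connect_sym.
  by case/connect_em=> ->.
exists (fun G c => c \o em), (fun G e => e \o rho); split=> //.
- move=> G c cD; split=> [|d|//].
    split=> [x|v]; last first.
      rewrite inE; apply/(fox_embed f r c v); have := cD.2 (f v).
      by rewrite S_codom codom_f.
    have := coloring_string cD (connect_runs (runsE x)). by [].
  exact/esym/(coloring_string cD)/rhoP.
- move=> G e eE; split=> [|x|j].
  + split=> [d|v].
      apply: rhoE => //; apply: connect_trans (rhoP d) (connect1 _).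
      by rewrite /string_rel /= eqxx.
    case: ifPn => [vS i|].
      apply: rhoE => //; apply: connect_trans (rhoP _) (connect1 _).
      by rewrite /string_rel /= vS eqxx orbT.
    rewrite S_codom negbK => /codomP[w ->]; apply/(fox_embed f r).
    have -> : (e \o rho) \o em = e.
      by apply: functional_extensionality => x; apply: rhoE.
    by have := eE.2 w; rewrite inE.
  + exact: rhoE.
  + by apply: (rhoE _ _ _ (inr j)) => //; apply: connect0.
Qed.

End Erasure.

(** * Reidemeister moves I and II *)

(** At a kink, the four darts have the same color in both kinds of coloring. *)
Lemma coloring_kink (n : nat) (X : finType) (g : dart n X -> dart n X)
    (v : X) (i : 'Z_4) (G : zmodType) (c : dart n X -> G) :
  g (inl (v, i)) = inl (v, i + 1) ->
  coloring g set0 c <-> coloring g [set v] c.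
Proof.
move=> gvi; split=> -[cg cX]; split=> // x; have := cX x.
  rewrite !inE; case: eqP => [->|//] cv.
  have c1 : c (inl (v, i + 1)) = c (inl (v, i)) by rewrite -gvi cg.
  suff [c2 c3] : c (inl (v, i + 2)) = c (inl (v, i)) /\
      c (inl (v, i + 3)) = c (inl (v, i)).
    by move=> k; case: (Z4_cases i k) => ->; rewrite ?Z4_add ?c3 ?c2 ?c1.
  case: (boolP (over i)) => oi.
    by have [-> ->] := cv i oi; rewrite c1 mirrorxx.
  have oi1 : over (i + 1) by rewrite overD.
  rewrite (fox_mirror oi1 oi cv) c1 mirrorxx.
  by have [+ _] := cv _ oi1; rewrite Z4_add c1.
rewrite !inE; case: eqP => [->|//] cv.
have c1 : c (inl (v, i + 1)) = c (inl (v, i)) by rewrite -gvi cg.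
have c2 := cv i; have := cv (i + 1); rewrite Z4_add c1 => c3 k _.
by case: (Z4_cases i k) => ->; rewrite ?Z4_add ?c3 ?c2 ?c1 mirrorxx.
Qed.

Lemma interchangeable_kink (n : nat) (X : finType) (g : dart n X -> dart n X)
    (v : X) (i : 'Z_4) :
  g (inl (v, i)) = inl (v, i + 1) ->
  interchangeable (bd X) (bd X) (coloring g set0) (coloring g [set v]).
Proof.
move=> gvi; exists (fun _ c => c), (fun _ c => c).
by split=> // G c; move/(coloring_kink _ gvi).
Qed.

(** At a bigon, the string that passes under changes its color at the first
    crossing and changes it back at the second one: the colorings differ only
    on the side of the bigon that passes under. *)
Lemma interchangeable_bigon (n : nat) (X : finType) (g : dart n X -> dart n X)
    (v w : X) (o u o' u' : 'Z_4) :
  involutive g -> v != w ->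
  g (inl (v, o)) = inl (w, o') -> g (inl (v, u)) = inl (w, u') ->
  over o -> over o' -> ~~ over u -> ~~ over u' ->
  interchangeable (bd X) (bd X) (coloring g set0) (coloring g [set v; w]).
Proof.
move=> gK vw gvo gvu oo oo' uu uu'.
(* The darts of the side of the bigon that passes under.  Their colors are
   replaced by those of the darts across the crossing, that is, by their
   reflections in the color of the string above. *)
pose side (d : dart n X) := (d == inl (v, u)) || (d == inl (w, u')).
have side_g d : side (g d) = side d.
  rewrite /side -[in RHS](inj_eq (can_inj gK)) gvu orbC.
  by rewrite -[in RHS](inj_eq (can_inj gK) d) -gvu gK.
have side_v k : side (inl (v, k)) = (k == u).
  by rewrite /side !(inj_eq inl_inj) !xpair_eqE eqxx (negPf vw) orbF.
have side_w k : side (inl (w, k)) = (k == u').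
  by rewrite /side !(inj_eq inl_inj) !xpair_eqE eqxx eq_sym (negPf vw).
have ou k : over k -> ((k == u) = false) * ((k == u') = false).
  by move=> ok; split; apply/eqP => ku; rewrite -ku ok in uu uu'.
have side_x x k : x != v -> x != w -> side (inl (x, k)) = false.
  by move=> /negPf xv /negPf xw; rewrite /side !(inj_eq inl_inj) !xpair_eqE xv xw.
have straight_at (G : zmodType) (c : dart n X -> G) x a : ~~ over a ->
    (forall k, side (inl (x, k)) = (k == a)) -> fox c x ->
    straight (fun d => if side d then c (through d) else c d) x.
  move=> ua sx cx k; rewrite !sx.
  by case: (Z4_cases a k) => ->; rewrite /= ?Z4_add ?Z4_neq ?eqxx //;
    have [] := cx (a + 1); rewrite ?overD // Z4_add => ->.
have fox_at (G : zmodType) (c : dart n X -> G) x b a :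
    over b -> ~~ over a -> c (inl (x, b)) = c (inl (v, o)) ->
    (forall k, side (inl (x, k)) = (k == a)) -> straight c x ->
    fox (fun d => if side d then mirror (c (inl (v, o))) (c d) else c d) x.
  move=> ob ua cb sx cx.
  have ba k : over k -> (k == a) = false.
    by move=> ok; apply/eqP => ka; rewrite -ka ok in ua.
  apply: (fox_mirrorI ob ua); rewrite /= !sx.
    by rewrite (ba b ob) ba ?overD.
  by rewrite (ba b ob) eqxx Z4_neq cb mirrorK.
exists (fun G c d => if side d then c (through d) else c d),
       (fun G c d => if side d then mirror (c (inl (v, o))) (c d) else c d).
split=> [|G c [cg cX]|G c [cg cX]].
- split=> G H h c d /=; first by case: ifP.
  by case: ifP => // _; rewrite mirror_additive.
- have cv : fox c v by have := cX v; rewrite inE.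
  have cw : fox c w by have := cX w; rewrite inE.
  have cu : c (inl (w, u' + 2)) = c (inl (v, u + 2)).
    rewrite (fox_mirror oo uu cv) (fox_mirror oo' uu' cw).
    by rewrite -gvo -gvu !cg.
  split=> [|d|//].
    split=> [d|x].
      rewrite side_g; case: ifP => [/orP[] /eqP ->|_]; rewrite ?cg //.
        by rewrite gvu /= cu.
      by rewrite -gvu gK gvu /= cu.
    rewrite !inE; case: eqP => [->|/eqP xv]; first exact: straight_at uu side_v cv.
    case: eqP => [->|/eqP xw]; first exact: straight_at uu' side_w cw.
    by have := cX x; rewrite inE => cx k ok /=; rewrite !side_x //; apply: cx.
  rewrite side_v (ou _ oo).1 /=; case sd: (side d) => //; case/orP: sd => /eqP ->.
    by rewrite /= (fox_mirror oo uu cv) mirrorK.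
  rewrite /= cu (fox_mirror oo uu cv) mirrorK.
  by rewrite -gvu cg.
have cv : straight c v by have := cX v; rewrite !inE eqxx.
have cw : straight c w by have := cX w; rewrite !inE eqxx orbT.
have co : c (inl (w, o')) = c (inl (v, o)) by rewrite -gvo cg.
split=> [|d|//].
  split=> [d|x].
    by rewrite side_g !cg.
  rewrite inE.
  case: (eqVneq x v) => [->|xv]; first exact: fox_at oo uu _ side_v cv.
  case: (eqVneq x w) => [->|xw]; first exact: fox_at oo' uu' co side_w cw.
  have := cX x; rewrite !inE (negPf xv) (negPf xw) => cx k ok.
  by rewrite !side_x //; apply: cx.
case sd: (side d) => //; case/orP: sd => /eqP -> /=.
  by rewrite side_v Z4_neq cv.
by rewrite side_w Z4_neq cw.
Qed.

(** * Reidemeister move III *)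

Lemma Z3_cases (t s : 'Z_3) : [\/ s = t, s = t + 1 | s = t - 1].
Proof.
have: [|| s == t, s == t + 1 | s == t - 1].
  by move: t s; do 2!case=> [[|[|[|//]]] ?].
by case/or3P => /eqP ->; [exact: Or31 | exact: Or32 | exact: Or33].
Qed.

Lemma Z3_add (t : 'Z_3) : (t + 1 + 1 = t - 1) * (t - 1 - 1 = t + 1).
Proof. by split; apply/eqP; move: t; case=> [[|[|[|//]]] ?]. Qed.

Section Triangle.
Variables (n : nat) (X : finType) (x : 'Z_3 -> X) (a : 'Z_3 -> 'Z_4).
Hypothesis x_inj : injective x.
Implicit Types (d : dart n X) (t : 'Z_3).

(** Each of the four darts at a corner takes the place of a dart at a
    neighboring corner. *)
Lemma slideE t : [/\ slide x a (inl (x t, a t)) = inl (x (t + 1), a (t + 1) + 3) :> dart n X,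
  slide x a (inl (x t, a t + 1)) = inl (x (t - 1), a (t - 1) + 2) :> dart n X,
  slide x a (inl (x t, a t + 2)) = inl (x (t + 1), a (t + 1) + 1) :> dart n X &
  slide x a (inl (x t, a t + 3)) = inl (x (t - 1), a (t - 1)) :> dart n X].
Proof.
rewrite /slide; case: pickP => [s /eqP/x_inj ->|/(_ t)]; last by rewrite eqxx.
by rewrite !eqxx !Z4_neq.
Qed.

Lemma slide_out v i : (forall t, x t != v) -> slide x a (inl (v, i)) = inl (v, i) :> dart n X.
Proof. by move=> xv; rewrite /slide; case: pickP => // t; rewrite (negPf (xv t)). Qed.

(** A dart is off the triangle, or is one of the darts at a corner. *)
Lemma corner_cases d : slide x a d = d \/ exists t,
  [\/ d = inl (x t, a t), d = inl (x t, a t + 1), d = inl (x t, a t + 2) |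
      d = inl (x t, a t + 3)].
Proof.
case: d => [[v i]|j]; last by left.
case: (pickP (fun t => x t == v)) => [t /eqP <-|xv].
  right; exists t; case: (Z4_cases (a t) i) => ->;
  by [exact: Or41 | exact: Or42 | exact: Or43 | exact: Or44].
by left; apply: slide_out => t; rewrite xv.
Qed.

Lemma slideK : involutive (@slide n X x a).
Proof.
move=> d; case: (corner_cases d) => [dd|[t]]; first by rewrite !dd.
have [s0 s1 s2 s3] := slideE t.
have [p0 p1 p2 p3] := slideE (t + 1); have [m0 m1 m2 m3] := slideE (t - 1).
rewrite ?addrK ?subrK in p0 p1 p2 p3 m0 m1 m2 m3.
by case=> ->; rewrite (s0, s1, s2, s3).
Qed.

(** The darts on the sides of the triangle. *)
Definition inner d : bool :=
  [exists t, (d == inl (x t, a t)) || (d == inl (x t, a t + 1))].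

Lemma innerP d : reflect
  (exists t, d = inl (x t, a t) \/ d = inl (x t, a t + 1)) (inner d).
Proof.
apply: (iffP existsP) => [[t /orP[]/eqP ->]|[t [->|->]]]; exists t.
- by left.
- by right.
- by rewrite eqxx.
- by rewrite eqxx orbT.
Qed.

(** The color, after the move, of the side of the triangle on the string
    through [x t] and [x (t + 1)]; the rule at the corner [x t] determines it
    from the colors of the outer darts at this corner. *)
Definition new_side (G : zmodType) (c : dart n X -> G) t : G :=
  let p := c (inl (x (t + 1), a (t + 1) + 3)) in
  if over (a t) then p else mirror (c (inl (x (t - 1), a (t - 1) + 2))) p.

(** The coloring after the move: outside of the triangle, the colors follow the
    strings. *)
Definition flip (G : zmodType) (c : dart n X -> G) d : G :=
  match d with
  | inl (v, i) =>
      match [pick t | x t == v] with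
      | Some t =>
          if i == a t + 2 then new_side c t
          else if i == a t + 3 then new_side c (t - 1)
          else c (slide x a d)
      | None => c (slide x a d)
      end
  | inr j => c d
  end.

Lemma flipE (G : zmodType) (c : dart n X -> G) t :
  [/\ flip c (inl (x t, a t)) = c (inl (x (t + 1), a (t + 1) + 3)),
    flip c (inl (x t, a t + 1)) = c (inl (x (t - 1), a (t - 1) + 2)),
    flip c (inl (x t, a t + 2)) = new_side c t &
    flip c (inl (x t, a t + 3)) = new_side c (t - 1)].
Proof.
have [s0 s1 s2 s3] := slideE t.
rewrite /flip; case: pickP => [s /eqP/x_inj ->|/(_ t)]; last by rewrite eqxx.
by rewrite !eqxx !Z4_neq s0 s1.
Qed.

Lemma flip_outer (G : zmodType) (c : dart n X -> G) d :
  ~~ inner (slide x a d) -> flip c d = c (slide x a d).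
Proof.
case: d => [[v i]|j] // /innerP; rewrite /flip; case: pickP => // t /eqP <- dT.
have [s0 s1 s2 s3] := slideE t.
case: eqP => [i2|_]; first by case: dT; exists (t + 1); rewrite i2 s2; right.
by case: eqP => [i3|_ //]; case: dT; exists (t - 1); rewrite i3 s3; left.
Qed.

Variable g : dart n X -> dart n X.
Hypothesis gK : involutive g.
Hypothesis gx : forall t, g (inl (x t, a t)) = inl (x (t + 1), a (t + 1) + 1).
Hypothesis layered : exists s t, over (a s) != over (a t).

Lemma gx1 t : g (inl (x t, a t + 1)) = inl (x (t - 1), a (t - 1)).
Proof. by rewrite -[inl (x (t - 1), _)]gK gx subrK. Qed.

Lemma inner_glue d : inner (g d) = inner d.
Proof.
have sub e : inner e -> inner (g e).
  case/innerP=> t [->|->]; apply/innerP; rewrite (gx, gx1).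
    by exists (t + 1); right.
  by exists (t - 1); left.
by apply/idP/idP; [rewrite -{2}[d]gK|]; apply: sub.
Qed.

Lemma not_all_over t :
  ~~ [&& over (a t), over (a (t + 1)) & over (a (t - 1))] /\
  [|| over (a t), over (a (t + 1)) | over (a (t - 1))].
Proof.
have [s [s' ss']] := layered; move: ss'.
case: (Z3_cases t s) => ->; case: (Z3_cases t s') => ->;
by case: (over (a t)); case: (over (a (t + 1))); case: (over (a (t - 1))).
Qed.

(** The side colored by the rule at [x (t - 1)] satisfies the rule at [x t];
    for the bottom string this is the distributivity of the reflections. *)
Lemma new_side_coherent (G : zmodType) (c : dart n X -> G) t :
  coloring g set0 c ->
  new_side c (t - 1) =
    let o := c (inl (x (t - 1), a (t - 1) + 2)) in
    if over (a t) then mirror (c (inl (x (t + 1), a (t + 1) + 3))) o else o.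
Proof.
case=> cg cX; rewrite /new_side subrK Z3_add /=.
have cI s : c (inl (x s, a s + 1)) = c (inl (x (s - 1), a (s - 1))).
  by rewrite -gx1 cg.
have rule s : if over (a s)
    then c (inl (x s, a s + 2)) = c (inl (x s, a s)) /\
      c (inl (x s, a s + 3)) = mirror (c (inl (x s, a s))) (c (inl (x (s - 1), a (s - 1))))
    else c (inl (x s, a s + 3)) = c (inl (x (s - 1), a (s - 1))) /\
      c (inl (x s, a s + 2)) = mirror (c (inl (x (s - 1), a (s - 1)))) (c (inl (x s, a s))).
  have := cX (x s); rewrite inE => cs; case: ifPn => os.
    by have [-> ->] := cs _ os; rewrite cI.
  have os1 : over (a s + 1) by rewrite overD.
  by have [+ _] := cs _ os1; rewrite (fox_mirror os1 os cs) Z4_add cI.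
move: (rule t) (rule (t + 1)) (rule (t - 1)); rewrite addrK Z3_add.
have [] := not_all_over t.
case: (over (a t)); case: (over (a (t + 1))); case: (over (a (t - 1))) => //= _ _;
  by move=> [r1 r2] [r3 r4] [r5 r6]; rewrite ?r1 ?r2 ?r3 ?r4 ?r5 ?r6 -?mirrorD ?mirrorK.
Qed.

Lemma coloring_flip (G : zmodType) (c : dart n X -> G) :
  coloring g set0 c ->
  coloring (fun d => slide x a (g (slide x a d))) set0 (flip c).
Proof.
move=> cc; have [cg cX] := cc; split=> [d|v].
  case: (boolP (inner (slide x a d))) => [|dT]; last first.
    rewrite !flip_outer ?slideK ?cg ?inner_glue //.
  case/innerP=> t [] sd.
    rewrite sd gx -[d]slideK sd.
    have [-> _ _ _] := slideE t; have [_ -> _ _] := slideE (t + 1).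
    have [_ _ _ ->] := flipE c (t + 1).
    by rewrite addrK; have [_ _ -> _] := flipE c t.
  rewrite sd gx1 -[d]slideK sd.
  have [_ -> _ _] := slideE t; have [-> _ _ _] := slideE (t - 1).
  have [_ _ -> _] := flipE c (t - 1).
  by rewrite subrK; have [_ _ _ ->] := flipE c t.
rewrite inE; case: (pickP (fun t => x t == v)) => [t /eqP <-|xv].
  have [f0 f1 f2 f3] := flipE c t; have J := new_side_coherent t cc.
  case: (boolP (over (a t))) => ot; rewrite ?ot ?(negPf ot) in J.
    apply: (foxI ot); rewrite ?f0 ?f1 ?f2 ?f3 //.
    by rewrite /new_side ot.
  have ot1 : over (a t + 1) by rewrite overD.
  apply: (fox_mirrorI ot1 ot); rewrite ?Z4_add ?f0 ?f1 ?f2 ?f3 //.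
  by rewrite /new_side (negPf ot).
have cv := cX v; rewrite inE in cv.
have fv i : flip c (inl (v, i)) = c (inl (v, i)).
  rewrite /flip; case: pickP => [t|_]; first by rewrite xv.
  by rewrite slide_out // => t; rewrite xv.
by move=> i oi; rewrite !fv; apply: cv.
Qed.

End Triangle.

(** After the move, the sides of the triangle are the opposite darts at the
    corners.  The same move with these darts leads back, so that on colorings
    [flip x a'] is the inverse of [flip x a]. *)
Section TriangleMove.
Variables (n : nat) (X : finType) (x : 'Z_3 -> X) (a : 'Z_3 -> 'Z_4).
Hypothesis x_inj : injective x.
Implicit Types (d : dart n X) (t : 'Z_3).
Let a' t := a t + 2.

Lemma slide_opposite : @slide n X x a' =1 slide x a.
Proof.
case=> [[v i]|j] //; rewrite /slide; case: pickP => // t _.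
by case: (Z4_cases (a t) i) => ->; rewrite /a' !Z4_add ?eqxx !Z4_neq ?Z4_neq.
Qed.

Variable g : dart n X -> dart n X.
Hypothesis gK : involutive g.
Hypothesis gx : forall t, g (inl (x t, a t)) = inl (x (t + 1), a (t + 1) + 1).
Hypothesis layered : exists s t, over (a s) != over (a t).

(* The gluing after the move. *)
Let g' d := slide x a (g (slide x a d)).

Lemma glue_slideK : involutive g'.
Proof. by move=> d; rewrite /g' slideK // gK slideK. Qed.

Lemma glue_slide_side t : g' (inl (x t, a' t)) = inl (x (t + 1), a' (t + 1) + 1).
Proof.
rewrite /g' /a'; have [_ _ -> _] := slideE n a x_inj t.
rewrite (gx1 gK gx) addrK; have [-> _ _ _] := slideE n a x_inj t.
by rewrite Z4_add.
Qed.

Lemma layered_opposite : exists s t, over (a' s) != over (a' t).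
Proof. by have [s [t st]] := layered; exists s, t; rewrite !overD. Qed.

Lemma glue_slide_opposite d : slide x a' (g' (slide x a' d)) = g d.
Proof. by rewrite !slide_opposite /g' !slideK. Qed.

Lemma flipK (G : zmodType) (c : dart n X -> G) :
  coloring g set0 c -> flip x a' (flip x a c) =1 c.
Proof.
move=> cc; have [cg cX] := cc.
have c'c' := coloring_flip x_inj gK gx layered cc.
have [c''g _] := coloring_flip x_inj glue_slideK glue_slide_side layered_opposite c'c'.
have at_side t : flip x a' (flip x a c) (inl (x t, a t)) = c (inl (x t, a t)).
  have [_ _ + _] := flipE a' x_inj (flip x a c) t.
  rewrite /a' Z4_add => ->; rewrite /new_side !overD !Z4_add.
  have [_ -> _ _] := flipE a x_inj c (t + 1); have [-> _ _ _] := flipE a x_inj c (t - 1).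
  rewrite addrK subrK; have := cX (x t); rewrite inE => ct.
  case: (boolP (over (a t))) => ot; first by have [] := ct _ ot.
  have ot1 : over (a t + 1) by rewrite overD.
  rewrite (fox_mirror ot1 ot ct); have [+ _] := ct _ ot1.
  by rewrite Z4_add => ->; rewrite mirrorK.
case=> [[v i]|//]; case: (pickP (fun t => x t == v)) => [t /eqP <-|xv]; last first.
  have out b (e : dart n X -> G) : flip x b e (inl (v, i)) = e (inl (v, i)).
    rewrite /flip; case: pickP => [t|_]; first by rewrite xv.
    by rewrite slide_out // => t; rewrite xv.
  by rewrite !out.
case: (Z4_cases (a t) i) => -> //.
(* A dart [a t + 1] is glued to a dart [a (t - 1)], for which see [at_side]. *)
- by rewrite -c''g glue_slide_opposite (gx1 gK gx) at_side -(gx1 gK gx) cg.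
- have [-> _ _ _] := flipE a' x_inj (flip x a c) t; rewrite /a' Z4_add.
  by have [_ -> _ _] := flipE a x_inj c (t + 1); rewrite addrK.
have [_ + _ _] := flipE a' x_inj (flip x a c) t; rewrite /a' !Z4_add => ->.
by have [-> _ _ _] := flipE a x_inj c (t - 1); rewrite subrK.
Qed.

End TriangleMove.

Lemma natural_flip (n : nat) (X : finType) (x : 'Z_3 -> X) (a : 'Z_3 -> 'Z_4) :
  natural (fun G => @flip n X x a G).
Proof.
have natJ (G H : zmodType) (h : {additive G -> H}) (c : dart n X -> G) t :
    new_side x a (h \o c) t = h (new_side x a c t).
  by rewrite /new_side /=; case: (over _); rewrite ?mirror_additive.
move=> G H h c [[v i]|j] //=; case: pickP => // t _.
by rewrite !natJ; case: (i == _) => //; case: (i == _).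
Qed.

Lemma interchangeable_triangle (n : nat) (X : finType) (g : dart n X -> dart n X)
    (x : 'Z_3 -> X) (a : 'Z_3 -> 'Z_4) :
  involutive g -> injective x ->
  (forall t, g (inl (x t, a t)) = inl (x (t + 1), a (t + 1) + 1)) ->
  (exists s t, over (a s) != over (a t)) ->
  interchangeable (bd X) (bd X) (coloring g set0)
    (coloring (fun d => slide x a (g (slide x a d))) set0).
Proof.
move=> gK xI gx layered; pose a' t := a t + 2.
pose g' d := slide x a (g (slide x a d)).
have g'K : involutive g' := glue_slideK a xI gK.
have g'x := glue_slide_side xI gK gx.
have l' : exists s t, over (a' s) != over (a' t) := layered_opposite layered.
have a'' : (fun t => a' t + 2) = a.
  by apply: functional_extensionality => t; rewrite /a' Z4_add.
have g'' : (fun d => slide x a' (g' (slide x a' d))) = g.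
  by apply: functional_extensionality => d; apply: glue_slide_opposite.
exists (fun G => @flip n X x a G), (fun G => @flip n X x a' G); split.
- by split; apply: natural_flip.
- by move=> G c cc; have cK := flipK xI gK gx layered cc; split=> //; apply: coloring_flip.
move=> G e ee; split=> //.
  by have := coloring_flip xI g'K g'x l' ee; rewrite g''.
by have := flipK xI g'K g'x l' ee; rewrite a''.
Qed.

(** * Invariance of the universal coloring *)

Lemma same_tangle_universal (n : nat) (D E : diagram n) (G : zmodType)
    (b : 'I_(n + n) -> G) :
  same_tangle D E ->
  universal (bd (crossing D)) (coloring (glue D) set0) b <->
  universal (bd (crossing E)) (coloring (glue E) set0) b.
Proof.
have transfer (Y Z : Type) (bY : 'I_(n + n) -> Y) (bZ : 'I_(n + n) -> Z) P Q :
    interchangeable bY bZ P Q -> universal bY P b <-> universal bZ Q b.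
  by move=> PQ; split; apply: universal_transfer => //; apply: interchangeable_sym.
elim=> {D E} [D E DE|D E|D E|D E|D E _ [DE ED]|D E F _ DE _ EF].
- exact/transfer/interchangeable_iso.
- case=> v [i [gvi [f [r [fI Sf runsE]]]]].
  apply: iff_trans (transfer _ _ _ _ _ _ (interchangeable_kink gvi)) _.
  exact/transfer/(interchangeable_erasure fI Sf runsE).
- case=> v [w [i [j [vw g1 g0 ij [f [r [fI Sf runsE]]]]]]].
  apply: iff_trans (transfer _ _ _ _ _ (coloring (glue D) [set v; w]) _) _; last first.
    exact/transfer/(interchangeable_erasure fI Sf runsE).
  have := overD i; have := overD j; move: ij.
  case: (boolP (over i)) => oi ij oj oi1; rewrite oi1 in ij.
    apply: (interchangeable_bigon (@glueK _ D) vw g0 g1);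
      by rewrite ?oi1 ?oj -?ij.
  apply: (interchangeable_bigon (@glueK _ D) vw g1 g0);
    by rewrite ?oi1 ?oj -?ij.
- case=> x [a [xI gx layered iso]].
  apply: iff_trans (transfer _ _ _ _ _ _ (interchangeable_triangle (@glueK _ D) xI gx layered)) _.
  exact: transfer _ _ _ _ _ _ (interchangeable_iso iso).
- by split.
exact: iff_trans DE EF.
Qed.

(** * The row lattice and the standard echelon form *)

(** The lattice generated by the rows of a matrix. *)
Definition row_lattice (p q : nat) (A : 'M[int]_(p, q)) (x : 'rV[int]_q) : Prop :=
  exists u, x = u *m A.

Section RowEquiv.
Variables (p q : nat).
Implicit Types (A B : 'M[int]_(p, q)).

Lemma row_equiv_trans A B C : row_equiv A B -> row_equiv B C -> row_equiv A C.
Proof.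
move=> AB; elim=> //.
- by move=> C' i1 i2 _; apply: row_equiv_swap.
- by move=> C' i1 i2 c ne _; apply: row_equiv_add.
- by move=> C' i1 _; apply: row_equiv_opp.
Qed.

Lemma row_lattice_sub r (A : 'M[int]_(r, q)) B :
  (exists T, A = T *m B) -> forall x, row_lattice A x -> row_lattice B x.
Proof. by case=> T -> x [u ->]; exists (u *m T); rewrite mulmxA. Qed.

Lemma row_equiv_unimodular A B : row_equiv A B ->
  (exists T, B = T *m A) /\ (exists T, A = T *m B).
Proof.
elim=> [|C i1 i2 _|C i1 i2 c ne _|C i1 _].
- by split; exists 1%:M; rewrite mul1mx.
- case=> -[T CT] [T' AT]; split; [exists (xrow i1 i2 T)|exists (xcol i1 i2 T')].
    by rewrite !xrowE -mulmxA -CT.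
  by rewrite xrowE xcolE -mulmxA [_ *m (_ *m C)]mulmxA -perm_mxM tperm2 perm_mx1 mul1mx.
- have E b : (\matrix_(i, j) (if i == i1 then C i j + b * C i2 j else C i j)) =
      (1%:M + b *: delta_mx i1 i2) *m C.
    apply/matrixP => i j; rewrite mulmxDl mul1mx -scalemxAl !mxE.
    rewrite (bigD1 i2) //= big1 => [|k /negPf ki]; last by rewrite mxE ki andbF mul0r.
    by rewrite addr0 !mxE eqxx andbT; case: eqP => _; rewrite ?mul1r ?mul0r ?mulr0 ?addr0.
  rewrite E; case=> -[T CT] [T' AT]; split.
    by exists ((1%:M + c *: delta_mx i1 i2) *m T); rewrite -mulmxA -CT.
  exists (T' *m (1%:M - c *: delta_mx i1 i2)).
  rewrite -mulmxA [_ *m (_ *m C)]mulmxA mulmxBl mul1mx mulmxDr mulmx1.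
  rewrite -scalemxAl -scalemxAr mul_delta_mx_0 1?eq_sym // !scaler0 addr0 addrK.
  by rewrite mul1mx.
- have E : (\matrix_(i, j) (if i == i1 then - C i j else C i j)) =
      (diag_mx (\row_i (if i == i1 then -1 else 1))) *m C.
    apply/matrixP => i j; rewrite mul_diag_mx !mxE.
    by case: eqP; rewrite ?mulN1r ?mul1r.
  rewrite E; set d := diag_mx _; case=> -[T CT] [T' AT]; split.
    by exists (d *m T); rewrite -mulmxA -CT.
  exists (T' *m d); rewrite -mulmxA [d *m (_ *m C)]mulmxA mulmx_diag.
  rewrite (_ : diag_mx _ = 1%:M) ?mul1mx //.
  by rewrite -diag_const_mx; congr diag_mx; apply/rowP => i; rewrite !mxE; case: eqP.
Qed.

Lemma row_equiv_lattice A B x : row_equiv A B -> row_lattice A x <-> row_lattice B x.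
Proof. by case/row_equiv_unimodular=> BA AB; split; apply: row_lattice_sub. Qed.

End RowEquiv.

(** ** Uniqueness *)

Section Uniqueness.
Variables (p q : nat).
Implicit Types (A B : 'M[int]_(p, q)).

Lemma leadingP A i j : A i j != 0 -> exists2 l : 'I_q, (l <= j)%N & leading A i l.
Proof.
move=> Aij; case: (@arg_minnP _ j (fun l => A i l != 0) (@nat_of_ord q) Aij) => l Ail lmin.
exists l; [exact: lmin|split=> // k kl].
by apply/eqP; apply: contraLR kl => Aik; rewrite -leqNgt lmin.
Qed.

(** Below a leading entry, an echelon matrix vanishes. *)
Lemma echelon_below A (i h : 'I_p) (j l : 'I_q) :
  echelon A -> leading A i j -> (i < h)%N -> (l <= j)%N -> A h l = 0.
Proof.
move=> eA ij ih lj; apply/eqP; case: eqP => // /eqP /leadingP[k kl hk].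
have [k' k'k [k'n k'0]] := eA _ _ _ ih hk.
have [jn j0] := ij; case: (ltngtP k' j) => [k'j|jk'|k'j].
- by rewrite j0 // eqxx in k'n.
- by have := leq_trans (ltn_trans jk' k'k) kl; rewrite ltnNge lj.
by have := leq_trans k'k kl; rewrite k'j ltnNge lj.
Qed.

(** In a combination of the rows that vanishes in the columns before [j], only
    the rows that vanish there have nonzero coefficients. *)
Lemma echelon_free (R : numDomainType) A (u : 'rV[R]_p) (j : nat) :
  echelon A -> (forall l : 'I_q, (l < j)%N -> (u *m map_mx intr A) 0 l = 0) ->
  forall (i : 'I_p) (l : 'I_q), (l < j)%N -> leading A i l -> u 0 i = 0.
Proof.
move=> eA uA i; have [k] := ubnP i; elim: k i => // k IH i; rewrite ltnS => ik l lj il.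
have := uA l lj; rewrite mxE (bigD1 i) //= big1 => [|h hi].
  by rewrite addr0 mxE => /eqP; rewrite mulf_eq0 intr_eq0 (negPf il.1) orbF => /eqP.
rewrite mxE; case: (ltngtP h i) => [hi'|ih|/val_inj he]; last by rewrite he eqxx in hi.
  have [l' l'l hl'] := eA _ _ _ hi' il.
  by rewrite (IH h (leq_trans hi' ik) l') ?mul0r // (ltn_trans l'l).
by rewrite (echelon_below eA il ih) // mulr0.
Qed.

Lemma echelon_free_int A (u : 'rV[int]_p) (j : nat) :
  echelon A -> (forall l : 'I_q, (l < j)%N -> (u *m A) 0 l = 0) ->
  forall (i : 'I_p) (l : 'I_q), (l < j)%N -> leading A i l -> u 0 i = 0.
Proof.
move=> eA uA; apply: (echelon_free (R := int) eA) => l lj.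
rewrite (_ : map_mx intr A = A) ?uA //.
by apply/matrixP => h k; rewrite mxE intz.
Qed.

(** Let the columns before [j] of a vector of the row lattice vanish: its entry
    in the column [j] is a multiple of the leading entry in this column, and
    vanishes if there is none. *)
Lemma echelon_col A (x : 'rV[int]_q) (j : 'I_q) :
  echelon A -> row_lattice A x -> (forall l : 'I_q, (l < j)%N -> x 0 l = 0) ->
  (forall i, leading A i j -> (A i j %| x 0%R j)%Z) /\
  (x 0 j != 0 -> exists i, leading A i j).
Proof.
move=> eA [u xu] x0; rewrite xu in x0.
have uA := echelon_free_int eA x0.
split=> [i ij|].
  rewrite xu mxE (bigD1 i) //= big1 ?addr0 ?dvdz_mull // => h hi.
  case: (ltngtP h i) => [hi'|ih|/val_inj he]; last by rewrite he eqxx in hi.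
    by have [k kj hk] := eA _ _ _ hi' ij; rewrite (uA _ _ kj hk) mul0r.
  by rewrite (echelon_below eA ij ih) ?mulr0.
rewrite xu mxE => ne; case: (pickP (fun i => (u 0 i * A i j) != 0)) => [i|z]; last first.
  by case/eqP: ne; apply: big1 => i _; apply/eqP; have := z i; case: eqP.
rewrite mulf_eq0 negb_or => /andP[ui Aij]; exists i.
have [l] := leadingP Aij; rewrite leq_eqVlt => /orP[/eqP/val_inj -> //|lj il].
by rewrite (uA _ _ lj il) eqxx in ui.
Qed.

Lemma row_lattice_row A i : row_lattice A (row i A).
Proof. by exists (delta_mx 0 i); rewrite rowE. Qed.

Lemma row_latticeB A x y : row_lattice A x -> row_lattice A y -> row_lattice A (x - y).
Proof. by move=> [u ->] [v ->]; exists (u - v); rewrite mulmxBl. Qed.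

Lemma standard_echelon_unique A B :
  standard_echelon A -> standard_echelon B ->
  (forall x, row_lattice A x <-> row_lattice B x) -> A = B.
Proof.
move=> [eA pA rA] [eB pB rB] AB.
suff cols j : forall (i : 'I_p) (l : 'I_q), (l < j)%N -> A i l = B i l.
  by apply/matrixP => i l; apply: (cols q).
elim: j => // j IHj i l; rewrite ltnS leq_eqVlt => /orP[/eqP lj|/IHj //].
(* If the column [l] of one of the matrices has a leading entry, so has that of
   the other one, in the same row and with the same value. *)
have lead A' B' i' : echelon A' -> echelon B' ->
    (forall x, row_lattice A' x -> row_lattice B' x) -> leading A' i' l ->
    exists2 h, leading B' h l & (B' h l %| A' i' l)%Z.
  move=> eA' eB' A'B' [ne z].
  have [||dv] := @echelon_col B' (row i' A') l eB'; rewrite ?mxE.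
  - exact/A'B'/row_lattice_row.
  - by move=> k kl; rewrite mxE z.
  by case/(_ ne)=> h hl; exists h => //; have := dv _ hl; rewrite mxE.
have same h h' : leading A h l -> leading B h' l -> h = h'.
  move=> Ahl Bhl; apply/val_inj; case: (ltngtP h h') => // [hh'|h'h].
    have [k kl [ne _]] := eB _ _ _ hh' Bhl; rewrite -IHj -?lj // in ne.
    by rewrite Ahl.2 // eqxx in ne.
  have [k kl [ne _]] := eA _ _ _ h'h Ahl; rewrite IHj -?lj // in ne.
  by rewrite Bhl.2 // eqxx in ne.
(* The difference of two corresponding rows is in the lattice; if it does not
   vanish in the column [l], then this column has a leading entry, which divides
   the difference and is larger than it, as both rows are reduced. *)
have dl : row_lattice A (row i A - row i B).
  by apply: row_latticeB; [|apply/AB]; apply: row_lattice_row.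
have [|dvd0 ex0] := echelon_col (j := l) eA dl.
  by move=> k kl; rewrite !mxE IHj ?subrr // -lj.
rewrite !mxE in dvd0 ex0.
case: (eqVneq (A i l - B i l) 0) => [/eqP|ne]; first by rewrite subr_eq0 => /eqP.
have [h hl] := ex0 ne; have [h' h'l BA] := lead _ _ _ eA eB (fun x => (AB x).1) hl.
have h'h := same _ _ hl h'l; subst h'.
have [h'' h''l ABh] := lead _ _ _ eB eA (fun x => (AB x).2) h'l.
have hh := same _ _ h''l h'l; subst h''.
have ABeq : A h l = B h l.
  have := pA _ _ hl; have := pB _ _ h'l => B0 A0.
  by apply/eqP; rewrite -[A h l]gtz0_abs // -[B h l]gtz0_abs // eqz_nat eqn_dvd;
     apply/andP; split.
have := dvd0 _ hl.
case: (ltngtP i h) => [ih|hi|/val_inj -> //].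
  have := rA _ _ hl _ ih; have := rB _ _ h'l _ ih; rewrite -ABeq.
  move=> /andP[b0 b1] /andP[a0 a1] /dvdzP[c cE]; exfalso; move/negP: ne; apply.
  have c0 : c = 0 by nia.
  by rewrite cE c0 mul0r.
by rewrite (echelon_below eA hl hi) ?(echelon_below eB h'l hi).
Qed.

End Uniqueness.

(** ** Existence *)

Section Existence.
Variables (p q : nat).
Implicit Types (A B : 'M[int]_(p, q)).

Lemma leading_unique A i (j l : 'I_q) : leading A i j -> leading A i l -> j = l.
Proof.
move=> [jn j0] [ln l0]; apply/val_inj; case: (ltngtP j l) => // [jl|lj].
  by rewrite l0 // eqxx in jn.
by rewrite j0 // eqxx in ln.
Qed.

Lemma leading_eq A B i (j : 'I_q) :
  (forall l : 'I_q, (l <= j)%N -> A i l = B i l) -> leading A i j -> leading B i j.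
Proof.
move=> AB [jn j0]; split; first by rewrite -AB.
by move=> l lj; rewrite -AB ?j0 // ltnW.
Qed.

(** The columns of [A] before [j] are in standard echelon form, with [r] leading
    entries. *)
Definition stage (j r : nat) A : Prop :=
  [/\ forall (i : 'I_p) (l : 'I_q), (r <= i)%N -> (l < j)%N -> A i l = 0,
      forall i : 'I_p, (i < r)%N -> exists2 l : 'I_q, (l < j)%N & leading A i l,
      forall (h i : 'I_p) (l : 'I_q), (h < i)%N -> (l < j)%N -> leading A i l ->
        exists2 k : 'I_q, (k < l)%N & leading A h k &
      forall (i : 'I_p) (l : 'I_q), (l < j)%N -> leading A i l ->
        0 < A i l /\ forall h : 'I_p, (h < i)%N -> 0 <= A h l <= A i l - 1].

Lemma stage_eq j r A B : (forall i (l : 'I_q), (l < j)%N -> B i l = A i l) ->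
  stage j r A -> stage j r B.
Proof.
move=> BA [z e inc red].
have lB i (l : 'I_q) : (l < j)%N -> leading A i l <-> leading B i l.
  move=> lj; split; apply: leading_eq => k kl; rewrite BA //; exact: leq_ltn_trans kl lj.
split=> [i l ri lj|i ir|h i l hi lj il|i l lj il].
- by rewrite BA // z.
- by have [l lj il] := e _ ir; exists l => //; apply/(lB i l lj).
- have [k kl hk] := inc h i l hi lj ((lB _ _ lj).2 il); exists k => //.
  by apply/lB => //; apply: ltn_trans kl lj.
have [pos res] := red i l lj ((lB _ _ lj).2 il).
by rewrite BA //; split=> // h hi; rewrite BA // res.
Qed.

Lemma stage_zero (c : 'I_q) r A : stage c r A ->
  (forall i : 'I_p, (r <= i)%N -> A i c = 0) -> stage c.+1 r A.
Proof.
move=> [z e inc red] Ac.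
have lc i (l : 'I_q) : (l < c.+1)%N -> leading A i l -> (l < c)%N.
  rewrite ltnS leq_eqVlt => /orP[/eqP/val_inj ->|//] ic.
  case: (ltnP i r) => [/e[k kc ik]|ri]; first by rewrite (leading_unique ik ic) ltnn in kc.
  by case: ic; rewrite Ac // eqxx.
split=> [i l ri|i ir|h i l hi lj il|i l lj il].
- by rewrite ltnS leq_eqVlt => /orP[/eqP/val_inj ->|/(z _ _ ri) //]; apply: Ac.
- by have [l lj il] := e _ ir; exists l => //; apply: ltnW.
- exact: inc hi (lc _ _ lj il) il.
exact: red (lc _ _ lj il) il.
Qed.

Lemma stage_pivot (c : 'I_q) (r : 'I_p) A : stage c r A -> 0 < A r c ->
  (forall i : 'I_p, (r < i)%N -> A i c = 0) ->
  (forall h : 'I_p, (h < r)%N -> 0 <= A h c <= A r c - 1) -> stage c.+1 r.+1 A.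
Proof.
move=> [z e inc red] Arc Ac red_c.
have rc : leading A r c by split=> [|l lc]; [rewrite gt_eqF|apply: z].
have lc i (l : 'I_q) : (l < c.+1)%N -> leading A i l -> (l < c)%N \/ i = r /\ l = c.
  rewrite ltnS leq_eqVlt => /orP[/eqP/val_inj ->|]; last by left.
  move=> ic; case: (ltngtP i r) => [/e[k kc ik]|ri|/val_inj ->]; last by right.
    by rewrite (leading_unique ik ic) ltnn in kc.
  by case: ic; rewrite Ac // eqxx.
split=> [i l ri|i|h i l hi lj il|i l lj il].
- rewrite ltnS leq_eqVlt => /orP[/eqP/val_inj ->|]; first exact: Ac.
  by apply: z; apply: ltnW.
- rewrite ltnS leq_eqVlt => /orP[/eqP/val_inj ->|/e[l lj il]]; first by exists c.
  by exists l => //; apply: ltnW.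
- case: (lc _ _ lj il) => [lc'|[ir ->]]; first exact: inc hi lc' il.
  by apply: e; rewrite -ir.
case: (lc _ _ lj il) => [lc'|[ir ->]]; first exact: red lc' il.
by rewrite ir.
Qed.

(** Euclid's algorithm in the column [c] of the rows from [r] on. *)
Lemma clear_column r (c : 'I_q) A :
  (forall (i : 'I_p) (l : 'I_q), (r <= i)%N -> (l < c)%N -> A i l = 0) ->
  exists B, [/\ row_equiv A B, forall i (l : 'I_q), (l < c)%N -> B i l = A i l,
    forall i : 'I_p, (r < i)%N -> B i c = 0 &
    forall i : 'I_p, r = i -> 0 <= B i c].
Proof.
pose size A := (\sum_(i < p | (r <= i)%N) `|A i c|)%N.
have [k] := ubnP (size A); elim: k A => // k IH A; rewrite ltnS => Ak z.
case: (pickP (fun ij : 'I_p * 'I_p => [&& (r <= ij.1)%N, (r <= ij.2)%N,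
    ij.1 != ij.2, A ij.2 c != 0 & (`|A ij.2 c| <= `|A ij.1 c|)%N])).
  move=> [i1 i2] /= /and5P[r1 r2 ne n2 le12].
  (* Replacing [A i1 c] by its remainder modulo [A i2 c] decreases [size]. *)
  pose B := \matrix_(i, j) (if i == i1 then A i j + - (A i1 c %/ A i2 c)%Z * A i2 j
                            else A i j).
  have AB : row_equiv A B by apply: row_equiv_add ne _; apply: row_equiv_refl.
  have Bl (i : 'I_p) (l : 'I_q) : (l < c)%N -> B i l = A i l.
    by move=> lc; rewrite mxE (z i2 l) // mulr0 addr0 if_same.
  have [||C [BC CB C0 Cpos]] := IH B.
  - apply: leq_trans Ak; rewrite /size (bigD1 i1) //= [leqRHS](bigD1 i1) //= -addSn leq_add //.
      rewrite mxE eqxx; apply: leq_trans le12; rewrite -ltz_nat !abszE.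
      rewrite mulNr [X in X - _](divz_eq _ (A i2 c)) addrC addKr.
      by rewrite ger0_norm ?modz_ge0 // ltz_mod.
    by apply: leq_sum => i /andP[_ /negPf ii]; rewrite mxE ii.
  - by move=> i l ri lc; rewrite Bl // z.
  exists C; split=> //; first exact: row_equiv_trans AB BC.
  by move=> i l lc; rewrite CB // Bl.
move=> le_all.
(* At most one of the entries in question is nonzero. *)
have one (i1 i2 : 'I_p) : (r <= i1)%N -> (r <= i2)%N -> A i1 c != 0 -> A i2 c != 0 -> i1 = i2.
  move=> r1 r2 n1 n2; apply/eqP; case: eqP => // /eqP ne.
  have := le_all (i1, i2); have := le_all (i2, i1).
  by rewrite /= r1 r2 n1 n2 [i2 == _]eq_sym ne /=; case: leqP => // /ltnW ->.
case: (pickP (fun i : 'I_p => (r <= i)%N && (A i c != 0))) => [i0 /andP[r0 n0]|none]; last first.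
  have A0 (i : 'I_p) : (r <= i)%N -> A i c = 0.
    by move=> ri; have := none i; rewrite ri /= => /negbT; rewrite negbK => /eqP.
  exists A; split=> //; first exact: row_equiv_refl.
    by move=> i /ltnW/A0.
  by move=> i ri; rewrite A0 // ri.
pose ro := Ordinal (leq_ltn_trans r0 (ltn_ord i0)).
pose B := xrow i0 ro A.
have AB : row_equiv A B by apply: row_equiv_swap; apply: row_equiv_refl.
have Bl (i : 'I_p) (l : 'I_q) : (l < c)%N -> B i l = A i l.
  move=> lc; rewrite !mxE; case: tpermP => [->|->|//]; by rewrite !z.
have B0 (i : 'I_p) : (r < i)%N -> B i c = 0.
  move=> ri; rewrite !mxE; apply/eqP; case: eqP => // /eqP; case: tpermP => [ii|ii|i1 i2] n.
  - have e := one _ _ (leqnn r : (r <= ro)%N) r0 n n0.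
    by rewrite ii -e ltnn in ri.
  - by rewrite ii ltnn in ri.
  by case: i1; apply: one => //; apply: ltnW.
case: (lerP 0 (B ro c)) => [B_ge0|B_lt0].
  by exists B; split=> // i ri; rewrite (_ : i = ro) //; apply: val_inj.
exists (\matrix_(i, j) (if i == ro then - B i j else B i j)); split.
- exact: row_equiv_opp.
- by move=> i l lc; rewrite mxE Bl //; case: eqP => [->|//]; rewrite z ?oppr0.
- by move=> i ri; rewrite mxE B0 // oppr0 if_same.
move=> i ri; rewrite (_ : i = ro); last exact: val_inj.
by rewrite mxE eqxx oppr_ge0 ltW.
Qed.

(** The entries above a positive entry in the column [c] are reduced modulo it. *)
Lemma reduce_column (r : 'I_p) (c : 'I_q) A :
  (forall l : 'I_q, (l < c)%N -> A r l = 0) -> 0 < A r c ->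
  exists B, [/\ row_equiv A B, forall i (l : 'I_q), (l < c)%N -> B i l = A i l,
    forall i : 'I_p, (r <= i)%N -> B i c = A i c &
    forall h : 'I_p, (h < r)%N -> 0 <= B h c <= A r c - 1].
Proof.
move=> z pos.
suff rows k : exists B, [/\ row_equiv A B,
    forall i (l : 'I_q), (l < c)%N -> B i l = A i l,
    forall i : 'I_p, (r <= i)%N -> B i c = A i c &
    forall h : 'I_p, (h < r)%N -> (h < k)%N -> 0 <= B h c <= A r c - 1].
  by have [B [AB Bl Bc red]] := rows p; exists B; split=> // h hr; apply: red.
elim: k => [|k [B [AB Bl Bc red]]].
  by exists A; split=> //; exact: row_equiv_refl.
case: (ltnP k r) => [kr|rk]; last first.
  exists B; split=> // h hr; rewrite ltnS leq_eqVlt => /orP[/eqP hk|/red -> //].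
  by move: hr; rewrite hk ltnNge rk.
have kp := ltn_trans kr (ltn_ord r); pose ko := Ordinal kp.
have ne : ko != r by rewrite -val_eqE /= ltn_eqF.
exists (\matrix_(i, j) (if i == ko then B i j + - (B ko c %/ A r c)%Z * B r j else B i j)).
split.
- exact: row_equiv_add.
- by move=> i l lc; rewrite mxE (Bl r l) // (z l) // mulr0 addr0 if_same Bl.
- move=> i ri; rewrite mxE Bc //; case: eqP => // ik; by move: ri; rewrite ik leqNgt kr.
move=> h hr; rewrite ltnS leq_eqVlt mxE => hk.
case: eqP => [->|hko].
  rewrite (Bc r) // mulNr [X in X - _](divz_eq _ (A r c)) addrC addKr.
  rewrite modz_ge0 ?gt_eqF //= -ltzD1 subrK.
  by rewrite -{2}[A r c]gtz0_abs // ltz_mod ?gt_eqF.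
case/orP: hk => [/eqP hk|]; last exact: red.
by case: hko; apply: val_inj.
Qed.

Lemma exists_stage A (j : nat) : (j <= q)%N ->
  exists B, row_equiv A B /\ exists2 r, (r <= p)%N & stage j r B.
Proof.
elim: j => [_|j IHj jq].
  exists A; split; first exact: row_equiv_refl.
  by exists 0%N; rewrite // /stage; split.
have [B [AB [r rp st]]] := IHj (ltnW jq); pose c : 'I_q := Ordinal jq.
have [z _ _ _] := st; have [C [BC Cl C0 Cpos]] := clear_column (c := c) z.
have AC := row_equiv_trans AB BC; have stC := stage_eq (j := j) Cl st.
move: rp; rewrite leq_eqVlt => /orP[/eqP rp|rp].
  exists C; split=> //; exists r; first by rewrite rp.
  apply: (stage_zero (c := c)) => // i; by rewrite rp leqNgt ltn_ord.
pose ro := Ordinal rp; case: (eqVneq (C ro c) 0) => [Cr|Cr].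
  exists C; split=> //; exists r; first exact: ltnW.
  apply: (stage_zero (c := c)) => // i; rewrite leq_eqVlt => /orP[/eqP ri|/C0 //].
  by rewrite (_ : i = ro) //; apply: val_inj.
have {Cr}Cr : 0 < C ro c by rewrite lt_neqAle eq_sym Cr Cpos.
have [|E [CE El Ec red]] := reduce_column (c := c) _ Cr.
  by move=> l lj; rewrite Cl // z.
exists E; split; first exact: row_equiv_trans AC CE.
exists r.+1 => //; apply: (stage_pivot (c := c) (r := ro)).
- exact: stage_eq El stC.
- by rewrite Ec.
- by move=> i ri; rewrite Ec ?C0 // ltnW.
by move=> h hr; rewrite [E ro c]Ec ?red.
Qed.

Lemma SF_spec A : row_equiv A (SF A) /\ standard_echelon (SF A).
Proof.
apply: (epsilon_spec (inhabits A) (fun S => row_equiv A S /\ standard_echelon S)).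
have [B [AB [r _ [_ _ inc red]]]] := exists_stage A (leqnn q).
exists B; split=> //; split=> [h i j hi ij|i j ij|i j ij h hi].
- exact: inc hi (ltn_ord j) ij.
- by case: (red i j (ltn_ord j) ij).
by have [_ ->] := red i j (ltn_ord j) ij.
Qed.

End Existence.

(** * Isomorphic cokernels *)

Lemma row_lattice_mx (p q k : nat) (U : 'M[int]_(p, q)) (A : 'M[int]_(k, q)) :
  (forall x : 'rV_k, row_lattice U (x *m A)) -> exists T, A = T *m U.
Proof.
move=> UA; have /fin_all_exists[t tP] i := UA (delta_mx 0 i).
exists (\matrix_i t i); apply/row_matrixP => i.
by rewrite rowE tP row_mul rowK.
Qed.

(** The rank of an integer matrix over the rational numbers. *)
Local Notation rk A := (\rank (map_mx intr A : 'M[rat]_(_, _))).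

(** [U] and [U'] are the relation matrices of two presentations of one group;
    [P] expresses the generators of the first one by those of the second one,
    and [Q] conversely. *)
Section Presentations.
Variables (m m' : nat) (U : 'M[int]_m) (U' : 'M[int]_m').
Variables (P : 'M[int]_(m, m')) (Q : 'M[int]_(m', m)).
Hypothesis PQ : forall x : 'rV_m, row_lattice U (x *m (P *m Q - 1%:M)).
Hypothesis QP : forall x : 'rV_m', row_lattice U' (x *m (Q *m P - 1%:M)).
Hypothesis UP : forall x : 'rV_m, row_lattice U' (x *m (U *m P)).
Hypothesis UQ : forall x : 'rV_m', row_lattice U (x *m (U' *m Q)).

(* Two sets of relations between the generators of both presentations: those of
   one presentation and the expressions of the other generators. *)
Let W := block_mx U 0 Q (- 1%:M).
Let W' := block_mx (- 1%:M) P 0 U'.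

(** Both sets of relations generate the same lattice. *)
Lemma joint_relations : (exists X, W' = X *m W) /\ (exists X, W = X *m W').
Proof.
have [T1 E1] := row_lattice_mx PQ; have [T2 E2] := row_lattice_mx UQ.
have [T3 E3] := row_lattice_mx QP; have [T4 E4] := row_lattice_mx UP.
split.
  exists (block_mx T1 (- P) T2 (- U')); rewrite mulmx_block -E1 -E2.
  by rewrite !mulNmx !mulmxN !mulmx1 !mulmx0 !opprK !add0r addrC addKr subrr.
exists (block_mx (- U) T4 (- Q) T3); rewrite mulmx_block -E3 -E4.
rewrite !mulNmx !mulmxN !mulmx1 !mulmx0 !opprK !addr0 addNr.
by rewrite addKr.
Qed.
Lemma presentation_det : `|\det U|%N = `|\det U'|%N.
Proof.
have [[X /(congr1 (fun A => `|\det A|%N)) E2] [X' /(congr1 (fun A => `|\det A|%N)) E1]] :=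
  joint_relations.
move: E1 E2.
rewrite !det_mulmx det_lblock det_ublock -!scaleN1r !detZ !det1 !mulr1.
rewrite !abszM !abszX !abszN1 !exp1n !mul1n !muln1 => E1 E2.
by apply/eqP; rewrite eqn_dvd; apply/andP; split; [rewrite E2|rewrite E1]; apply: dvdn_mull.
Qed.

Lemma presentation_nullity : (m - rk U = m' - rk U')%N.
Proof.
have [[X WX] [X' WX']] := joint_relations.
have rW : rk W = rk W'.
  apply/eqP; rewrite eqn_leq; apply/andP.
  by split; [rewrite WX'|rewrite WX]; rewrite map_mxM mxrankM_maxr.
have rN k : \rank (- 1%:M : 'M[rat]_k) = k by rewrite mxrank_opp mxrank1.
suff [rL rR] : rk W = (rk U + m')%N /\ rk W' = (m + rk U')%N.
  move: rW; rewrite rL rR; have := rank_leq_row (map_mx intr U : 'M[rat]_m).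
  by have := rank_leq_row (map_mx intr U' : 'M[rat]_m'); lia.
rewrite /W /W' !map_block_mx !map_mxN !map_mx1 !map_mx0; split.
  rewrite -[RHS](congr1 (addn _) (rN m')) -rank_diag_block_mx.
  pose V : 'M[rat]_(m + m') := block_mx 1%:M 0 (map_mx intr Q) 1%:M.
  have VU : row_free V by rewrite row_free_unit unitmxE det_lblock !det1 mulr1 unitr1.
  rewrite -(mxrankMfree _ VU) mulmx_block.
  by rewrite !mulNmx !mulmx1 !mulmx0 !mul0mx !mul1mx !addr0 addrN add0r.
rewrite -[RHS](congr1 (addn^~ _) (rN m)) -rank_diag_block_mx.
pose V : 'M[rat]_(m + m') := block_mx 1%:M (map_mx intr P) 0 1%:M.
have VU : row_free V by rewrite row_free_unit unitmxE det_ublock !det1 mulr1 unitr1.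
rewrite -[LHS](mxrankMfree _ VU) mulmx_block.
by rewrite !mulNmx !mulmx1 !mulmx0 !mul0mx !mul1mx !addr0 addNr add0r.
Qed.
End Presentations.

(** * The invariants of a standard echelon form *)

Section EchelonShape.
Variables (p q : nat) (A : 'M[int]_(p, q)).
Hypothesis eA : echelon A.

Lemma echelon_diag (i : 'I_p) (j : 'I_q) : leading A i j -> (i <= j)%N.
Proof.
case: i => i ip; elim: i ip j => [|i IH] ip j // ij.
have [l lj il] := @eA (Ordinal (ltnW ip)) (Ordinal ip) j (ltnSn i) ij.
exact: leq_ltn_trans (IH _ _ il) lj.
Qed.

Lemma echelon_low (i : 'I_p) (l : 'I_q) : (l < i)%N -> A i l = 0.
Proof.
move=> li; apply/eqP; case: eqP => // /eqP /leadingP[k kl /echelon_diag ik].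
by have := leq_ltn_trans (leq_trans ik kl) li; rewrite ltnn.
Qed.

(** The nonzero rows of an echelon matrix are the first ones, and their number
    is the rank. *)
Lemma echelon_rank : exists2 r, rk A = r &
  [/\ (r <= p)%N, forall (i : 'I_p) l, (r <= i)%N -> A i l = 0 &
      forall i : 'I_p, (i < r)%N -> exists l, leading A i l].
Proof.
pose Z k := [forall i : 'I_p, (k <= i)%N ==> [forall l, A i l == 0]].
have Zp : exists k, Z k.
  by exists p; apply/forallP => i; rewrite leqNgt ltn_ord.
have [r Zr rmin] := ex_minnP Zp.
have rp : (r <= p)%N by apply: rmin; apply/forallP => i; rewrite leqNgt ltn_ord.
have A0 (i : 'I_p) l : (r <= i)%N -> A i l = 0.
  by move=> ri; have /forallP/(_ i)/implyP/(_ ri)/forallP/(_ l)/eqP := Zr.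
have Al (i : 'I_p) : (i < r)%N -> exists l, leading A i l.
  move=> ir; have : ~~ Z i by apply/negP => /rmin; rewrite leqNgt ir.
  case/forallPn => h; rewrite negb_imply => /andP[ih /forallPn[l /leadingP[k _ hk]]].
  move: ih; rewrite leq_eqVlt => /orP[/eqP/val_inj ->|ih]; first by exists k.
  by have [k' _ ik'] := eA ih hk; exists k'.
exists r; last by [].
(* The left kernel consists of the vectors whose first [r] entries vanish. *)
pose B : 'M[rat]_(p, q) := map_mx intr A.
have kerB : (kermx B :=: copid_mx r)%MS.
  apply/eqmxP/andP; split.
    apply/row_subP => k; set u := row k _.
    have uB : u *m B = 0 by apply/sub_kermxP; apply: row_sub.
    have u0 (i : 'I_p) : (i < r)%N -> u 0 i = 0.
      move=> ir; have [l il] := Al i ir.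
      by apply: (echelon_free (j := q) eA) (ltn_ord l) il => l' _; rewrite uB mxE.
    move: u uB u0 => u uB u0; apply/submxP; exists u; apply/rowP => i.
    rewrite [RHS]mxE (bigD1 i) //= big1 => [|h hi].
      rewrite addr0 !mxE !eqxx /=; case: ltnP => [ir|_].
        by rewrite u0 // mul0r.
      by rewrite subr0 mulr1.
    by rewrite !mxE (inj_eq val_inj) (negPf hi) /= subrr mulr0.
  apply/sub_kermxP/matrixP => i l; rewrite mxE big1 ?mxE // => h _.
  rewrite !mxE; case: (ltnP h r) => [hr|rh]; last by rewrite A0 // mulr0.
  case: (eqVneq i h) => [->|/negPf ih]; first by rewrite eqxx hr subrr mul0r.
  by rewrite (inj_eq val_inj) ih subrr mul0r.
have := mxrank_ker B; rewrite kerB rank_copid_mx //.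
by rewrite -/B; have := rank_leq_row B; lia.
Qed.

End EchelonShape.

(** The rows of a standard echelon form that vanish in the first [m] columns;
    [r] is the number of the other ones. *)
Section Tail.
Variables (p m q r k : nat) (S : 'M[int]_(p, m + q)) (e : (r + k = p)%N).
Hypothesis sS : standard_echelon S.
Hypothesis S0 : forall (i : 'I_p) (l : 'I_m), (r <= i)%N -> S i (lshift q l) = 0.
Hypothesis Sl : forall i : 'I_p, (i < r)%N -> exists l : 'I_m, leading S i (lshift q l).

Let f (i : 'I_k) : 'I_p := cast_ord e (rshift r i).
Definition tail : 'M[int]_(k, q) := \matrix_(i, j) S (f i) (rshift m j).

Lemma leading_tail i j : leading tail i j <-> leading S (f i) (rshift m j).
Proof.
rewrite /leading mxE; split=> -[ne z]; split=> // l.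
  case: (split_ordP l) => l' -> => [_|]; first by rewrite S0 ?leq_addr.
  by rewrite ltn_add2l => /z; rewrite mxE.
by move=> lj; rewrite mxE z //= ltn_add2l.
Qed.

Lemma standard_echelon_tail : standard_echelon tail.
Proof.
have [eS pS rS] := sS.
split=> [h i j hi /leading_tail ij|i j /leading_tail/pS|i j /leading_tail ij h hi].
- have [|l lj hl] := eS (f h) _ _ _ ij; first by rewrite ltn_add2l.
  case: (split_ordP l) hl lj => l' -> hl lj.
    by case: hl; rewrite S0 ?leq_addr // eqxx.
  by exists l'; [rewrite ltn_add2l in lj|apply/leading_tail].
- by rewrite mxE.
by rewrite !mxE; apply: rS ij _ _; rewrite ltn_add2l.
Qed.

Lemma row_mx_tail : row_mx 0 tail = rowsub f S.
Proof.
apply/matrixP => i l; rewrite !mxE; case: (split_ordP l) => l' ->.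
  by rewrite mxE S0 ?leq_addr.
by rewrite mxE.
Qed.

Lemma mul_tail (u : 'rV[int]_p) : (forall i : 'I_p, (i < r)%N -> u 0 i = 0) ->
  u *m S = colsub f u *m rowsub f S.
Proof.
rewrite /f; case: p / e S u => S' u u0; apply/rowP => l.
rewrite !mxE big_split_ord /= big1 => [|i _]; last first.
  by rewrite (u0 _ (ltn_ord i : (lshift k i < r)%N)) mul0r.
by rewrite add0r; apply: eq_bigr => i _; rewrite !mxE cast_ord_id.
Qed.

Lemma row_lattice_tail (y : 'rV[int]_q) :
  row_lattice tail y <-> row_lattice S (row_mx 0 y).
Proof.
split=> [[u ->]|[u yu]].
  exists (u *m rowsub f 1%:M); rewrite -mulmxA -rowsubE -row_mx_tail.
  by rewrite mul_mx_row mulmx0.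
have u0 (i : 'I_p) : (i < r)%N -> u 0 i = 0.
  move=> ir; have [l il] := Sl ir; have [eS _ _] := sS.
  apply: (echelon_free_int (j := m) eS _ (ltn_ord l : (lshift q l < m)%N) il) => l' lm.
  rewrite -yu mxE; case: split_ordP => l'' le; first by rewrite mxE.
  by move: lm; rewrite le /= ltnNge leq_addr.
exists (colsub f u); move: yu; rewrite mul_tail // -row_mx_tail mul_mx_row.
by move/eq_row_mx => [].
Qed.

End Tail.

(** The corners of a matrix in standard echelon form. *)
Section Corner.
Variables (m n : nat) (S : 'M[int]_(m + n, m + (n + n))).
Hypothesis sS : standard_echelon S.
Local Notation U := (ulsubmx S).

Lemma corner_dl : dlsubmx S = 0.
Proof.
have [eS _ _] := sS; apply/matrixP => i j.
by rewrite !mxE echelon_low //= (leq_trans (ltn_ord j)) ?leq_addr.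
Qed.

Lemma corner_lattice (x : 'rV_(m + (n + n))) :
  row_lattice S x -> row_lattice U (lsubmx x).
Proof.
case=> u ->; exists (lsubmx u).
rewrite -{1}[S]submxK -{1}[u]hsubmxK mul_row_block row_mxKl corner_dl.
by rewrite mulmx0 addr0.
Qed.

Lemma corner_lift (y : 'rV_m) :
  row_lattice U y -> exists z, row_lattice S (row_mx y z).
Proof.
case=> u ->; exists (u *m ursubmx S); exists (row_mx u 0).
by rewrite -[in RHS](submxK S) mul_row_block !mul0mx !addr0.
Qed.

Lemma echelon_corner : echelon U.
Proof.
have [eS _ _] := sS.
have lead i (j : 'I_m) : leading U i j <-> leading S (lshift n i) (lshift (n + n) j).
  rewrite /leading !mxE; split=> -[ne z]; split=> // l lj; last by rewrite !mxE z.
  have lm : (l < m)%N := ltn_trans lj (ltn_ord j).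
  by have := z (Ordinal lm) lj; rewrite !mxE => <-; congr (S _ _); apply: val_inj.
move=> h i j hi /lead ij; have [l lj hl] := eS (lshift n h) (lshift n i) _ hi ij.
have lm : (l < m)%N := ltn_trans lj (ltn_ord j).
exists (Ordinal lm) => //; apply/lead.
by rewrite (_ : lshift _ _ = l) //; apply: val_inj.
Qed.

(** The lower right corner is formed by the last rows of a standard echelon
    form of the lattice of the [y] such that [row_mx 0 y] is in the lattice of
    [S]; the number of rows of this form is fixed by the nullity of [U]. *)
Lemma corner_tail : exists N : 'M[int]_((m - rk U) + n, n + n),
  [/\ standard_echelon N,
      forall y, row_lattice N y <-> row_lattice S (row_mx 0 y) &
      drsubmx S = dsubmx N].
Proof.
have [eS _ _] := sS; have [r -> [rm U0 Ul]] := echelon_rank echelon_corner.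
have e : (r + ((m - r) + n) = m + n)%N by rewrite addnA subnKC.
have S0 (i : 'I_(m + n)) (l : 'I_m) : (r <= i)%N -> S i (lshift (n + n) l) = 0.
  case: (split_ordP i) => i' -> ri; first by have := U0 i' l ri; rewrite !mxE.
  by rewrite echelon_low //= (leq_trans (ltn_ord l)) ?leq_addr.
have Sl (i : 'I_(m + n)) : (i < r)%N -> exists l : 'I_m, leading S i (lshift (n + n) l).
  case: (split_ordP i) => i' -> /= ir; last first.
    by have := leq_trans ir rm; rewrite ltnNge leq_addr.
  have [l [ne _]] := Ul i' ir; rewrite !mxE in ne.
  have [k kl ik] := leadingP ne; have km : (k < m)%N := leq_ltn_trans kl (ltn_ord l).
  by exists (Ordinal km); rewrite (_ : lshift _ _ = k) //; apply: val_inj.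
exists (tail S e); split.
- exact: standard_echelon_tail.
- exact: row_lattice_tail.
apply/matrixP => i j; rewrite !mxE; congr (S _ _); apply: val_inj => /=.
by rewrite addnA subnKC.
Qed.

End Corner.

Section CornerInvariance.
Variables (m m' n : nat).
Variables (S : 'M[int]_(m + n, m + (n + n))) (S' : 'M[int]_(m' + n, m' + (n + n))).

(** [F] induces a homomorphism of the cokernels that preserves the classes of
    the last generators. *)
Definition cokernel_map (F : 'M[int]_(m + (n + n), m' + (n + n))) : Prop :=
  (forall x, row_lattice S x -> row_lattice S' (x *m F)) /\
  forall z : 'rV_(n + n), row_lattice S' (row_mx 0 z *m F - row_mx 0 z).

Hypotheses (sS : standard_echelon S) (sS' : standard_echelon S').
Variable F : 'M[int]_(m + (n + n), m' + (n + n)).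
Hypothesis SF : cokernel_map F.

Lemma cokernel_map_dl (z : 'rV_(n + n)) :
  row_lattice (ulsubmx S') (z *m dlsubmx F).
Proof.
have [_ F0] := SF; have := corner_lattice sS' (F0 z).
rewrite -[in row_mx 0 z *m F](submxK F) mul_row_block !mul0mx !add0r.
by rewrite linearB /= !row_mxKl subr0.
Qed.

Lemma cokernel_map_ul (x : 'rV_m) :
  row_lattice (ulsubmx S') (x *m (ulsubmx S *m ulsubmx F)).
Proof.
have [|z yz] := corner_lift (S := S) (y := x *m ulsubmx S); first by exists x.
have [SS' _] := SF; have := corner_lattice sS' (SS' _ yz).
rewrite -[in row_mx _ z *m F](submxK F) mul_row_block row_mxKl -mulmxA => H.
rewrite -[X in row_lattice _ X](addrK (z *m dlsubmx F)).
exact: row_latticeB H (cokernel_map_dl z).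
Qed.

Lemma cokernel_map_tail (y : 'rV_(n + n)) :
  row_lattice S (row_mx 0 y) -> row_lattice S' (row_mx 0 y).
Proof.
have [SS' F0] := SF => /SS' yF.
rewrite -[row_mx 0 y](subKr (row_mx 0 y *m F)).
exact: row_latticeB yF (F0 y).
Qed.

End CornerInvariance.

Lemma cokernel_map_comp (m m' n : nat)
    (S : 'M[int]_(m + n, m + (n + n))) (S' : 'M[int]_(m' + n, m' + (n + n)))
    (F : 'M[int]_(m + (n + n), m' + (n + n))) (F' : 'M[int]_(m' + (n + n), m + (n + n))) :
  standard_echelon S -> cokernel_map S' S F' ->
  (forall x, row_lattice S (x *m F *m F' - x)) ->
  forall x : 'rV_m, row_lattice (ulsubmx S) (x *m (ulsubmx F *m ulsubmx F' - 1%:M)).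
Proof.
move=> sS mF' FF' x; have := corner_lattice sS (FF' (row_mx x 0)).
rewrite -{1}[F]submxK -{1}[F']submxK !mul_row_block !mul0mx !addr0.
rewrite linearB /= !row_mxKl -mulmxA => H.
rewrite mulmxBr mulmx1 -[_ - x](addrK (x *m ursubmx F *m dlsubmx F')).
rewrite [_ - x + _]addrAC; apply: row_latticeB H _.
exact: (cokernel_map_dl sS mF').
Qed.

Lemma corner_invariance (m m' n : nat)
    (S : 'M[int]_(m + n, m + (n + n))) (S' : 'M[int]_(m' + n, m' + (n + n)))
    (F : 'M[int]_(m + (n + n), m' + (n + n))) (F' : 'M[int]_(m' + (n + n), m + (n + n))) :
  standard_echelon S -> standard_echelon S' ->
  cokernel_map S S' F -> cokernel_map S' S F' ->
  (forall x, row_lattice S (x *m F *m F' - x)) ->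
  (forall x, row_lattice S' (x *m F' *m F - x)) ->
  `|\det (ulsubmx S)|%N = `|\det (ulsubmx S')|%N /\ drsubmx S = drsubmx S'.
Proof.
move=> sS sS' mF mF' FF' F'F.
have PQ := cokernel_map_comp sS mF' FF'; have QP := cokernel_map_comp sS' mF F'F.
have UP := cokernel_map_ul sS' mF; have UQ := cokernel_map_ul sS mF'.
split; first exact: presentation_det PQ QP UP UQ.
have [N [sN NS ->]] := corner_tail sS; have [N' [sN' NS' ->]] := corner_tail sS'.
move: N sN NS; rewrite (presentation_nullity PQ QP UP UQ) => N sN NS.
congr dsubmx; apply: standard_echelon_unique sN sN' _ => y.
split=> [/NS yS|/NS' yS].
  exact/NS'/(cokernel_map_tail mF).
exact/NS/(cokernel_map_tail mF').
Qed.

(** * The cokernel of a coloring matrix *)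

Section Cokernel.
Variables (p q : nat) (A : 'M[int]_(p, q)).

(** Membership in the lattice as a boolean predicate, decided classically. *)
Definition row_lattice_pred : {pred 'rV[int]_q} :=
  fun x => if excluded_middle_informative (row_lattice A x) then true else false.

Lemma row_lattice_predP x : reflect (row_lattice A x) (x \in row_lattice_pred).
Proof. by rewrite unfold_in; case: excluded_middle_informative => ?; constructor. Qed.

Lemma row_lattice_zmod_closed : zmod_closed row_lattice_pred.
Proof.
split=> [|x y /row_lattice_predP Ax /row_lattice_predP Ay]; apply/row_lattice_predP.
  by exists 0; rewrite mul0mx.
exact: row_latticeB.
Qed.

HB.instance Definition _ :=
  GRing.isZmodClosed.Build 'rV[int]_q row_lattice_pred row_lattice_zmod_closed.

(** The quotient group by the row lattice, with the projection [pi] and a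
    section [s]. *)
Lemma exists_cokernel : exists (G : zmodType) (pi : {additive 'rV[int]_q -> G})
    (s : G -> 'rV[int]_q), cancel s pi /\ forall x, pi x = 0 <-> row_lattice A x.
Proof.
pose G := Quotient.quot row_lattice_pred.
pose pi : {additive 'rV[int]_q -> G} := \pi_G%qT.
exists G, pi, (@generic_quotient.repr _ G); split=> [x|x].
  by rewrite /pi /= generic_quotient.reprK.
rewrite -(raddf0 pi); split=> [/eqP|/row_lattice_predP xA].
  by rewrite -Quotient.idealrBE subr0 => /row_lattice_predP.
by apply/eqP; rewrite -Quotient.idealrBE subr0.
Qed.

End Cokernel.

Lemma additive_row_eq (q : nat) (G : zmodType) (h k : {additive 'rV[int]_q -> G}) :
  (forall i, h (delta_mx 0 i) = k (delta_mx 0 i)) -> h =1 k.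
Proof.
move=> hk x; rewrite [x]row_sum_delta !raddf_sum; apply: eq_bigr => i _.
by rewrite -[x 0 i]intz scaler_int !raddfMz hk.
Qed.

Lemma additive_row_exists (q : nat) (G : zmodType) (v : 'I_q -> G) :
  exists k : {additive 'rV[int]_q -> G}, forall i, k (delta_mx 0 i) = v i.
Proof.
pose k (x : 'rV[int]_q) := \sum_i v i *~ x 0 i.
have kB : zmod_morphism k.
  move=> x y; rewrite /k -sumrB; apply: eq_bigr => i _.
  by rewrite !mxE mulrzBr.
pose kM := GRing.isZmodMorphism.Build _ _ k kB.
pose k' : {additive 'rV[int]_q -> G} := HB.pack k kM.
exists k' => i; rewrite /= /k (bigD1 i) //= big1 => [|j ji].
  by rewrite mxE !eqxx addr0.
by rewrite mxE (negPf ji) andbF.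
Qed.

(** Additive maps that vanish on the rows factor through the cokernel. *)
Lemma additive_factor (p q : nat) (A : 'M[int]_(p, q)) (G H : zmodType)
    (pi : {additive 'rV[int]_q -> G}) (s : G -> 'rV[int]_q)
    (k : {additive 'rV[int]_q -> H}) :
  cancel s pi -> (forall x, pi x = 0 <-> row_lattice A x) ->
  (forall i, k (row i A) = 0) ->
  exists h : {additive G -> H}, forall x, h (pi x) = k x.
Proof.
move=> sK piA kA.
have k0 x : pi x = 0 -> k x = 0.
  case/piA=> u ->; rewrite mulmx_sum_row raddf_sum big1 // => i _.
  by rewrite -[u 0 i]intz scaler_int raddfMz kA mul0rz.
have kE x y : pi x = pi y -> k x = k y.
  move=> xy; apply/eqP; rewrite -subr_eq0 -raddfB; apply/eqP/k0.
  by rewrite raddfB xy subrr.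
pose h g := k (s g).
have hB : zmod_morphism h.
  by move=> x y; rewrite /h -raddfB; apply: kE; rewrite raddfB !sK.
pose hM := GRing.isZmodMorphism.Build _ _ h hB.
pose h' : {additive G -> H} := HB.pack h hM.
by exists h' => x; apply: kE; rewrite sK.
Qed.

Section ColoringMatrix.
Variables (n : nat) (D : diagram n).
Local Notation arc := (connect (arc_rel (glue D))).
Implicit Types (d : dart n (crossing D)).

Lemma arc_sym : connect_sym (arc_rel (glue D)).
Proof.
apply: sym_connect_sym.
suff sub d d' : arc_rel (glue D) d d' -> arc_rel (glue D) d' d.
  by move=> d d'; apply/idP/idP; apply: sub.
rewrite /arc_rel /=; case/orP=> [/eqP ->|/andP[od /eqP ->]]; first by rewrite glueK eqxx.
have -> : is_over (through d) = is_over d by case: (d) => [[v i]|j] //=; rewrite overD.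
by rewrite od throughK eqxx orbT.
Qed.

Lemma mem_arc (A : {set dart n (crossing D)}) d d' :
  A \in arcs D -> d \in A -> (d' \in A) = arc d d'.
Proof.
case/imsetP=> e _ ->; rewrite !inE /= => ed.
by rewrite (same_connect arc_sym ed).
Qed.

Lemma arc_interior (B : interior_arc D) :
  val B \in arcs D /\ forall j, inr j \notin val B.
Proof. by case: B => A /= /andP[AD /forallP]. Qed.

(** A variable of an arc is one at each of its darts. *)
Lemma variable_arc d d' x : variable_at d x -> arc d d' -> variable_at d' x.
Proof.
case: x => [B|j] /=; last exact: connect_trans.
by move=> dB dd'; rewrite (mem_arc _ (arc_interior B).1 dB).
Qed.

Lemma variable_at_arc d d' x : variable_at d x -> variable_at d' x -> arc d d'.
Proof.
case: x => [B|j] /= => [dB|jd jd']; first by rewrite (mem_arc _ (arc_interior B).1 dB).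
by rewrite arc_sym in jd; apply: connect_trans jd jd'.
Qed.

Lemma exists_variable_at d : exists x, variable_at d x.
Proof.
case: (boolP [exists j, arc (inr j) d]) => [/existsP[j jd]|]; first by exists (inr j).
rewrite negb_exists => /forallP no_end.
pose A : {set dart n (crossing D)} := [set d' in [set: dart n (crossing D)] | arc d d'].
have AD : A \in arcs D by apply/imsetP; exists d.
have int : (A \in arcs D) && [forall j : 'I_(n + n), inr j \notin A].
  by rewrite AD; apply/forallP => j; rewrite !inE /= arc_sym.
by exists (inl (Sub A int)); rewrite /= !inE connect0.
Qed.

Lemma exists_dart_at x : exists d, variable_at d x.
Proof.
case: x => [B|j] /=; last by exists (inr j); apply: connect0.
have [/imsetP[d _ Bd] _] := arc_interior B.
by exists d; rewrite Bd !inE connect0.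
Qed.

Lemma coloring_arc (G : zmodType) (c : dart n (crossing D) -> G) d d' :
  coloring (glue D) set0 c -> arc d d' -> c d' = c d.
Proof.
case=> cg cX /connectP[p dp ->] {d'}.
elim: p d dp => //= e p IHp d /andP[de /IHp ->].
case/orP: de => [/eqP -> //|/andP[+ /eqP ->]].
case: d => [[v i]|j] //= oi.
by have := cX v; rewrite inE => /(_ i oi)[].
Qed.

Variables (sigma : {perm 'I_(n + n)}) (m : nat) (M : 'M[int]_(m + n, m + (n + n))).
Hypothesis MD : coloring_matrix D sigma M.

(** The cokernel of a coloring matrix is the universal group of the diagram, the
    color of the endpoint [j] being the class of the generator of its column. *)
Lemma coloring_matrix_universal (G : zmodType)
    (pi : {additive 'rV[int]_(m + (n + n)) -> G}) (s : G -> 'rV[int]_(m + (n + n))) :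
  cancel s pi -> (forall x, pi x = 0 <-> row_lattice M x) ->
  universal (bd (crossing D)) (coloring (glue D) set0)
    (fun j => pi (delta_mx 0 (rshift m ((sigma^-1)%g j)))).
Proof.
move=> sK piM; have [iota [rho [M0 [[iota' iotaK iotaK'] [rho' rhoK rhoK'] M0E M0M]]]] := MD.
have piM0 x : pi x = 0 <-> row_lattice M0 x.
  exact: iff_trans (piM x) (iff_sym (row_equiv_lattice x M0M)).
(* The column of a variable. *)
pose col (x : variable D) : 'I_(m + (n + n)) :=
  match x with inl B => lshift _ (iota' B) | inr j => rshift m ((sigma^-1)%g j) end.
have colK j : col (column_variable sigma iota j) = j.
  rewrite /column_variable; case: split_ordP => i -> /=; first by rewrite iotaK.
  by rewrite permK.
have colK' x : column_variable sigma iota (col x) = x.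
  rewrite /column_variable; case: x => [B|j] /=.
    by rewrite (unsplitK (inl _)) iotaK'.
  by rewrite (unsplitK (inr _)) permKV.
have colE j x : (column_variable sigma iota j == x) = (j == col x).
  by rewrite -{1}[x]colK' (can_eq colK).
pose e (x : variable D) : 'rV[int]_(m + (n + n)) := delta_mx 0 (col x).
(* The relations between the generators. *)
have row_crossing v : exists x y z, [/\ variable_at (inl (v, 1)) x,
    variable_at (inl (v, 0)) y, variable_at (inl (v, 2)) z &
    row (rho' (inl v)) M0 = e y + e z - e x *+ 2].
  have [c + cE] := M0E (rho' (inl v)); rewrite rhoK' => -[x [y [z [xv yv zv cxyz]]]].
  exists x, y, z; split=> //; apply/rowP => j.
  by rewrite mulr2n !mxE cE cxyz !colE mulr_natl mulr2n.
have row_uncut w : row (rho' (inr w)) M0 = e (inr (val w).1) - e (inr (val w).2).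
  have [c + cE] := M0E (rho' (inr w)); rewrite rhoK' /= => cw.
  by apply/rowP => j; rewrite !mxE cE cw !colE.
have pi_row i : pi (row i M0) = 0 by apply/piM0/row_lattice_row.
(* Two variables at one dart have the same class, so that the darts are colored
   by the classes of the variables. *)
have pi_uncut i j : arc (inr i) (inr j) -> pi (e (inr i)) = pi (e (inr j)).
  have lt (i' j' : 'I_(n + n)) : (i' < j')%N -> arc (inr i') (inr j') ->
      pi (e (inr i')) = pi (e (inr j')).
    move=> ij aij.
    have w : (i' < j')%N && arc (inr i') (inr j') by rewrite ij.
    have := pi_row (rho' (inr (Sub (i', j') w))).
    by rewrite row_uncut /= raddfB => /eqP; rewrite subr_eq0 => /eqP.
  case: (ltngtP i j) => [/lt //|/lt ji|/val_inj -> //].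
  by rewrite arc_sym => /ji.
have pi_at d x y : variable_at d x -> variable_at d y -> pi (e x) = pi (e y).
  case: x y => [B|i] [C|j] /=.
  - move=> dB dC; congr (pi (e (inl _))); apply/val_inj/setP => d'.
    by rewrite (mem_arc _ (arc_interior B).1 dB) (mem_arc _ (arc_interior C).1 dC).
  - move=> dB; rewrite arc_sym -(mem_arc _ (arc_interior B).1 dB).
    by rewrite (negPf ((arc_interior B).2 j)).
  - rewrite arc_sym => di dC; move: di; rewrite -(mem_arc _ (arc_interior C).1 dC).
    by rewrite (negPf ((arc_interior C).2 i)).
  by move=> id; rewrite arc_sym => dj; apply: pi_uncut; apply: connect_trans id dj.
have /fin_all_exists[var varP] := exists_variable_at.
have /fin_all_exists[rep repP] := exists_dart_at.
pose c d := pi (e (var d)).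
have cE d x : variable_at d x -> c d = pi (e x) by apply: pi_at (varP d).
have c_arc d d' : arc d d' -> c d' = c d.
  by move=> dd'; apply: cE; apply: variable_arc (varP d) dd'.
exists c; split=> [|j|H c' c'D].
- split=> [d|v].
    by apply: c_arc; apply: connect1; rewrite /arc_rel /= eqxx.
  rewrite inE; have [x [y [z [xv yv zv E]]]] := row_crossing v.
  apply: (@fox_mirrorI _ _ _ _ _ 1 0) => //.
    by apply: c_arc; apply: connect1; rewrite /arc_rel /= eqxx orbT.
  rewrite add0r (cE _ _ xv) (cE _ _ yv) (cE _ _ zv).
  have := pi_row (rho' (inl v)); rewrite E raddfB raddfD raddfMn /mirror.
  by move/eqP; rewrite subr_eq0 => /eqP <-; rewrite addrAC subrr add0r.
- by rewrite (cE _ (inr j)) //=; apply: connect0.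
(* A coloring [c'] gives values [v] to the variables, which satisfy the
   equations. *)
pose v (x : variable D) : H := c' (rep x).
have vE d x : variable_at d x -> v x = c' d.
  by move=> dx; apply: coloring_arc c'D (variable_at_arc dx (repP x)).
have [k kE] := additive_row_exists (fun j => v (column_variable sigma iota j)).
have ke (x : variable D) : k (e x) = v x by rewrite /e kE colK'.
have kM i : k (row i M0) = 0.
  rewrite -[i]rhoK; case: (rho i) => [w|w].
    have [x [y [z [xv yv zv ->]]]] := row_crossing w.
    rewrite raddfB raddfD raddfMn !ke (vE _ _ xv) (vE _ _ yv) (vE _ _ zv).
    have [_ /(_ w)] := c'D; rewrite inE => cw.
    have := @fox_mirror _ _ _ _ w 1 0 isT isT cw; rewrite add0r => ->.
    by rewrite /mirror [_ + (_ - _)]addrC subrK subrr.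
  rewrite row_uncut raddfB !ke; case: w => -[i1 i2] /= /andP[_ a12].
  have v1 : v (inr i1) = c' (inr i1) by apply: vE; apply: connect0.
  have v2 : v (inr i2) = c' (inr i1) by apply: vE; rewrite /= arc_sym.
  by rewrite v1 v2 subrr.
have [h hE] := additive_factor sK piM0 kM.
exists h; split=> [d|h' h'E g]; first by rewrite hE ke; apply: vE.
have at_e (x : variable D) : h' (pi (e x)) = h (pi (e x)).
  by rewrite -(cE _ _ (repP x)) h'E /c hE ke (vE (rep x)).
rewrite -[g]sK; apply: (@additive_row_eq _ _ (h' \o pi) (h \o pi)) => j.
by have := at_e (column_variable sigma iota j); rewrite /e colK.
Qed.

End ColoringMatrix.

(** A homomorphism between cokernels that respects the last generators lifts to
    a matrix. *)
Lemma cokernel_lift (m m' n : nat)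
    (A : 'M[int]_(m + n, m + (n + n))) (A' : 'M[int]_(m' + n, m' + (n + n)))
    (G G' : zmodType)
    (pi : {additive 'rV[int]_(m + (n + n)) -> G})
    (pi' : {additive 'rV[int]_(m' + (n + n)) -> G'}) (s' : G' -> 'rV[int]_(m' + (n + n)))
    (h : {additive G -> G'}) :
  (forall x, pi x = 0 <-> row_lattice A x) ->
  (forall x, pi' x = 0 <-> row_lattice A' x) -> cancel s' pi' ->
  (forall b, h (pi (delta_mx 0 (rshift m b))) = pi' (delta_mx 0 (rshift m' b))) ->
  exists F, cokernel_map A A' F /\ forall x, pi' (x *m F) = h (pi x).
Proof.
move=> piA piA' sK' hb.
pose F : 'M[int]_(m + (n + n), m' + (n + n)) :=
  \matrix_i s' (h (pi (delta_mx 0 i))).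
have FE x : pi' (x *m F) = h (pi x).
  apply: (@additive_row_eq _ _ (pi' \o mulmxr F) (h \o pi)) => i /=.
  by rewrite -rowE rowK sK'.
exists F; split=> //; split=> [x /piA xA|z].
  by apply/piA'; rewrite FE xA raddf0.
apply/piA'; rewrite raddfB FE; apply/eqP; rewrite subr_eq0; apply/eqP.
have e k b : row_mx 0 (delta_mx 0 b) = delta_mx 0 (rshift k b) :> 'rV[int]_(k + (n + n)).
  apply/rowP => j; rewrite !mxE; case: split_ordP => l ->.
    by rewrite mxE eqxx eq_lrshift.
  by rewrite !mxE !eqxx eq_rshift.
(* By additivity in [z], it is enough to consider the last generators. *)
have last k : linear (row_mx 0 : 'rV[int]_(n + n) -> 'rV[int]_(k + (n + n))).
  by move=> a x y; rewrite scale_row_mx add_row_mx scaler0 addr0.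
pose lM k := GRing.isLinear.Build _ _ _ _ _ (@last k).
pose l k : {linear 'rV[int]_(n + n) -> 'rV[int]_(k + (n + n))} := HB.pack (row_mx 0) (lM k).
apply: (@additive_row_eq _ _ (h \o pi \o l m) (pi' \o l m')) => b /=.
by rewrite !e hb.
Qed.

Theorem mainTheorem1 (n : nat) (n_gt0 : (0 < n)%N)
    (sigma : {perm 'I_(n + n)}) (D E : diagram n) (DE : same_tangle D E)
    (m m' : nat)
    (M : 'M[int]_(m + n, m + (n + n))) (M' : 'M[int]_(m' + n, m' + (n + n)))
    (MD : coloring_matrix D sigma M) (ME : coloring_matrix E sigma M') :
  dU M = dU M' /\ Ml M = Ml M'.
Proof.
have [MS sS] := SF_spec M; have [MS' sS'] := SF_spec M'.
have [G [pi [s [sK piM]]]] := exists_cokernel M.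
have [G' [pi' [s' [sK' piM']]]] := exists_cokernel M'.
have /(same_tangle_universal _ DE) univ := coloring_matrix_universal MD sK piM.
have univ' := coloring_matrix_universal ME sK' piM'.
have [h [h' [hK hK' hb hb']]] := universal_iso univ univ'.
have piS x : pi x = 0 <-> row_lattice (SF M) x.
  exact: iff_trans (piM x) (row_equiv_lattice x MS).
have piS' x : pi' x = 0 <-> row_lattice (SF M') x.
  exact: iff_trans (piM' x) (row_equiv_lattice x MS').
have [|F [mF FE]] := cokernel_lift (h := h) piS piS' sK'.
  by move=> b; have := hb (sigma b); rewrite permK.
have [|F' [mF' FE']] := cokernel_lift (h := h') piS' piS sK.
  by move=> b; have := hb' (sigma b); rewrite permK.
have [||dd tt] := corner_invariance sS sS' mF mF' _ _.
- by move=> x; apply/piS; rewrite raddfB FE' FE hK subrr.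
- by move=> x; apply/piS'; rewrite raddfB FE FE' hK' subrr.
by rewrite /dU /Ml -!abszE dd tt.
Qed.
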